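(* Let $A$ be a finite dimensional basic algebra over a field $K$, with $n$ simple modules up to isomorphism. Suppose that $U$ and $V$ are two finitely generated right $A$-modules with the same Newton polytope, i.e. $\mathcal N(U)=\mathcal N(V)$. Then the following statements hold. (i) For any $\delta\in\mathbb R^n$, with associated semistable torsion class $\overline{\mathcal T}_\delta$, $U\in\overline{\mathcal T}_\delta$ if and only if $V\in\overline{\mathcal T}_\delta$. In particular, for any $\tau$-tilting pair $(M,P)$, $U\in\mathsf{Fac}\,M$ if and only if $V\in\mathsf{Fac}\,M$. (ii) If $U$ and $V$ are left finite, then $\langle U\rangle_{\rm tors}=\langle V\rangle_{\rm tors}$. (iii) If $U$ and $V$ are left finite bricks, then $U\cong V$. (iv) If $U$ and $V$ are indecomposable $\tau$-rigid modules, then $U\cong V$. (v) If $U$ and $V$ are $\tau$-rigid modules, then $U\oplus V$ is $\tau$-rigid.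
   Context: $\mathsf{mod}\,A$ is the category of finitely generated right $A$-modules, $\tau$ is the Auslander-Reiten translation in $\mathsf{mod}\,A$, and $n$ is the number of isomorphism classes of simple $A$-modules. The dimension vector of a module $X\in\mathsf{mod}\,A$ is the vector in $\mathbb Z_{\ge 0}^n$ whose $i$-th entry is the multiplicity of the $i$-th simple module as a composition factor of $X$. Newton polytope: for $U\in\mathsf{mod}\,A$, $\mathcal N(U)\subset\mathbb R^n$ is the convex hull of the dimension vectors of all quotient modules of $U$. For $\delta\in\mathbb R^n$ and $X\in\mathsf{mod}\,A$, $\delta(X)\in\mathbb R$ denotes the standard inner product of $\delta$ with the dimension vector of $X$. Put $$\overline{\mathcal T}_\delta=\{N\in\mathsf{mod}\,A\mid \delta(X)\ge 0\text{ for every quotient module }X\text{ of }N\}.$$ This is a torsion class; torsion classes of the form $\overline{\mathcal T}_\delta$ with $\delta\in\mathbb R^n$ are called semistable torsion classes. For $M\in\mathsf{mod}\,A$: $\mathsf{add}\,M$ is the additive closure of $M$ (direct summands of finite direct sums of copies of $M$); $\mathsf{Fac}\,M$ is the class of factor modules of modules in $\mathsf{add}\,M$; $|M|$ is the number of pairwise non-isomorphic indecomposable direct summands of $M$ (so $|A|=n$). $M\in\mathsf{mod}\,A$ is $\tau$-rigid if $\operatorname{Hom}_A(M,\tau M)=0$. A pair $(M,P)$ with $M\in\mathsf{mod}\,A$ and $P\in\mathsf{mod}\,A$ projective is $\tau$-rigid if $M$ is $\tau$-rigid and $\operatorname{Hom}_A(P,M)=0$; it is $\tau$-tilting if it is $\tau$-rigid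 and $|M|+|P|=|A|$. A torsion class is a full subcategory of $\mathsf{mod}\,A$ closed under quotients and extensions; it is functorially finite if it equals $\mathsf{Fac}\,M$ for some $M\in\mathsf{mod}\,A$. For $N\in\mathsf{mod}\,A$, $\langle N\rangle_{\rm tors}$ is the smallest torsion class containing $N$. The module $N$ is left finite if $\langle N\rangle_{\rm tors}$ is functorially finite. A module $S\in\mathsf{mod}\,A$ is a brick if $\operatorname{End}_A(S)$ is a division algebra. *)

(* Defs.v *)
From HB Require Import structures.
From mathcomp Require Import all_boot all_order all_algebra all_field.
From mathcomp Require Import boolp classical_sets reals convex.

Set Implicit Arguments.
Unset Strict Implicit.
Unset Printing Implicit Defensive.

Import GRing.Theory.
Local Open Scope classical_set_scope.
Local Open Scope ring_scope.

(* A right A-module is finitely generated iff it is finite dimensional over K;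
   mod A is therefore modelled by finite dimensional K-spaces carrying a
   K-bilinear, unital and associative right action of A.  (An explicit action
   is needed because a type cannot be canonically an lmodType over both K and
   A^c.) *)
Record rmod (K : fieldType) (A : falgType K) := RMod {
  rmod_car :> vectType K;
  ract : rmod_car -> A -> rmod_car;
  ract_linearl : forall a, linear (ract^~ a);
  ract_linearr : forall x, linear (ract x);
  ract1 : forall x, ract x 1 = x;
  ractM : forall x a b, ract x (a * b) = ract (ract x a) b
}.

Record lmod (K : fieldType) (A : falgType K) := LMod {
  lmod_car :> vectType K;
  lact : A -> lmod_car -> lmod_car;
  lact_linearl : forall x, linear (lact^~ x);
  lact_linearr : forall a, linear (lact a);
  lact1 : forall x, lact 1 x = x;
  lactM : forall a b x, lact (a * b) x = lact a (lact b x)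
}.

Section Constructions.
Variables (K : fieldType) (A : falgType K).

Definition reg_act (x : A) (a : A) : A := x * a.

Fact reg_act_linearl a : linear (reg_act^~ a).
Proof. by move=> k x y; rewrite /reg_act mulrDl scalerAl. Qed.

Fact reg_act_linearr x : linear (reg_act x).
Proof. by move=> k a b; rewrite /reg_act mulrDr scalerAr. Qed.

Fact reg_act1 x : reg_act x 1 = x. Proof. exact: mulr1. Qed.

Fact reg_actM x a b : reg_act x (a * b) = reg_act (reg_act x a) b.
Proof. exact: mulrA. Qed.

Definition regmod : rmod A :=
  RMod reg_act_linearl reg_act_linearr reg_act1 reg_actM.

Definition zero_act (x : 'rV[K]_0) (a : A) : 'rV[K]_0 := 0.

Fact zero_act_linearl a : linear (zero_act^~ a).
Proof. by move=> k x y; rewrite /zero_act scaler0 addr0. Qed.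

Fact zero_act_linearr x : linear (zero_act x).
Proof. by move=> k a b; rewrite /zero_act scaler0 addr0. Qed.

Fact zero_act1 x : zero_act x 1 = x. Proof. by rewrite [RHS]thinmx0. Qed.

Fact zero_actM x a b : zero_act x (a * b) = zero_act (zero_act x a) b.
Proof. by []. Qed.

Definition zero_mod : rmod A :=
  RMod zero_act_linearl zero_act_linearr zero_act1 zero_actM.

Section DirectSum.
Variables X Y : rmod A.

Definition dsum_act (u : X * Y) (a : A) : X * Y := (ract u.1 a, ract u.2 a).

Fact dsum_act_linearl a : linear (dsum_act^~ a).
Proof. by move=> k [x y] [x' y']; congr pair; exact: ract_linearl. Qed.

Fact dsum_act_linearr u : linear (dsum_act u).
Proof. by move=> k a b; congr pair; exact: ract_linearr. Qed.

Fact dsum_act1 u : dsum_act u 1 = u.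
Proof. by case: u => x y; rewrite /dsum_act !ract1. Qed.

Fact dsum_actM u a b : dsum_act u (a * b) = dsum_act (dsum_act u a) b.
Proof. by rewrite /dsum_act !ractM. Qed.

Definition dsum : rmod A :=
  RMod dsum_act_linearl dsum_act_linearr dsum_act1 dsum_actM.

End DirectSum.

Definition dsums (s : seq (rmod A)) : rmod A := foldr dsum zero_mod s.

(* The standard duality D = Hom_K(-, K) from left to right modules, with
   (phi . a)(x) = phi (a x). *)
Section Duality.
Variable L : lmod A.

HB.instance Definition _ (a : A) :=
  GRing.isLinear.Build K L L *:%R (lact a) (lact_linearr a).

Definition dual_act (phi : 'Hom(L, K^o)) (a : A) : 'Hom(L, K^o) :=
  (phi \o linfun (lact a))%VF.

Fact dual_actE phi a x : dual_act phi a x = phi (lact a x).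
Proof. by rewrite /dual_act !lfunE /= lfunE. Qed.

Fact dual_act_linearl a : linear (dual_act^~ a).
Proof.
move=> k phi psi; apply/lfunP => x.
by rewrite dual_actE add_lfunE scale_lfunE add_lfunE scale_lfunE !dual_actE.
Qed.

Fact dual_act_linearr phi : linear (dual_act phi).
Proof.
move=> k a b; apply/lfunP => x.
by rewrite add_lfunE scale_lfunE !dual_actE lact_linearl linearP.
Qed.

Fact dual_act1 phi : dual_act phi 1 = phi.
Proof. by apply/lfunP => x; rewrite dual_actE lact1. Qed.

Fact dual_actM phi a b : dual_act phi (a * b) = dual_act (dual_act phi a) b.
Proof. by apply/lfunP => x; rewrite !dual_actE lactM. Qed.

Definition dual_mod : rmod A :=
  RMod dual_act_linearl dual_act_linearr dual_act1 dual_actM.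

End Duality.

End Constructions.

Section ModuleCategory.
Variables (K : fieldType) (A : falgType K).
Implicit Types L M N P S T U X Y Z : rmod A.

Definition is_hom X Y (f : 'Hom(X, Y)) : Prop :=
  forall x a, f (ract x a) = ract (f x) a.

Definition hom_zero X Y : Prop := forall f : 'Hom(X, Y), is_hom f -> f = 0.

Definition mono X Y (f : 'Hom(X, Y)) : Prop := lker f = 0%VS.

Definition epi X Y (f : 'Hom(X, Y)) : Prop := limg f = fullv.

Definition iso_mod X Y : Prop :=
  exists f : 'Hom(X, Y), [/\ is_hom f, mono f & epi f].

Definition short_exact X Y Z (f : 'Hom(X, Y)) (g : 'Hom(Y, Z)) : Prop :=
  [/\ is_hom f /\ is_hom g, mono f, limg f = lker g & epi g].

Definition quotient_of U X : Prop :=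
  exists g : 'Hom(U, X), is_hom g /\ epi g.

Definition direct_summand M X : Prop := exists Y, iso_mod M (dsum X Y).

Definition is_submod X (W : {vspace X}) : Prop :=
  forall x a, x \in W -> ract x a \in W.

Definition is_zero X : Prop := forall x : X, x = 0.

Definition simple_mod X : Prop :=
  ~ is_zero X /\
  forall W : {vspace X}, is_submod W -> W = 0%VS \/ W = fullv.

Definition indecomposable X : Prop :=
  ~ is_zero X /\ forall Y Z, iso_mod X (dsum Y Z) -> is_zero Y \/ is_zero Z.

Definition brick S : Prop :=
  ~ is_zero S /\
  forall f : 'End(S), is_hom f -> f <> 0 ->
    exists g : 'End(S), [/\ is_hom g, (g \o f)%VF = \1%VF & (f \o g)%VF = \1%VF].

Definition pairwise_noniso (I : Type) (X : I -> rmod A) : Prop :=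
  forall i j, iso_mod (X i) (X j) -> i = j.

Definition simple_reps n (S : 'I_n -> rmod A) : Prop :=
  [/\ forall i, simple_mod (S i), pairwise_noniso S &
      forall X, simple_mod X -> exists i, iso_mod X (S i)].

(* [num_summands M k] reads |M| = k. *)
Definition num_summands M (k : nat) : Prop :=
  exists X : 'I_k -> rmod A,
    [/\ forall i, indecomposable (X i) /\ direct_summand M (X i),
        pairwise_noniso X &
        forall Y, indecomposable Y -> direct_summand M Y ->
          exists i, iso_mod Y (X i)].

Definition basic_algebra : Prop :=
  exists k (P : 'I_k -> rmod A),
    [/\ forall i, indecomposable (P i), pairwise_noniso P &
        iso_mod (regmod A) (dsums [seq P i | i <- enum 'I_k])].

Definition projective_mod P : Prop :=
  forall X Y (p : 'Hom(X, Y)) (h : 'Hom(P, Y)),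
    is_hom p -> epi p -> is_hom h ->
    exists2 l : 'Hom(P, X), is_hom l & h = (p \o l)%VF.

Definition superfluous X (W : {vspace X}) : Prop :=
  forall N : {vspace X}, is_submod N -> (N + W)%VS = fullv -> N = fullv.

Definition minimal_projective_presentation P1 P0 M
    (f : 'Hom(P1, P0)) (g : 'Hom(P0, M)) : Prop :=
  [/\ projective_mod P1 /\ projective_mod P0, is_hom f /\ is_hom g,
      limg f = lker g /\ epi g, superfluous (lker g) &
      superfluous (lker f)].

Definition hom_reg_lact P (a : A) (h : 'Hom(P, regmod A)) :
    'Hom(P, regmod A) :=
  ((amull a : 'End(regmod A)) \o h)%VF.

(* L is a transpose Tr M: the left module L is a cokernel of
   Hom_A(f, A) : Hom_A(P0, A) -> Hom_A(P1, A) for a minimal projective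
   presentation P1 -f-> P0 -> M -> 0.  The cokernel map, defined on the subspace
   Hom_A(P1, A) of Hom_K(P1, A), is given by a K-linear map pi on the whole of
   Hom_K(P1, A), of which only the restriction matters. *)
Definition is_transpose M (L : lmod A) : Prop :=
  exists P1 P0 (f : 'Hom(P1, P0)) (g : 'Hom(P0, M)),
    minimal_projective_presentation f g /\
    exists pi : 'Hom('Hom(P1, regmod A), L),
      [/\ forall l, exists2 h, is_hom h & pi h = l,
          forall a h, is_hom h -> pi (hom_reg_lact a h) = lact a (pi h) &
          forall h, is_hom h ->
            (pi h = 0 <->
             exists2 k : 'Hom(P0, regmod A), is_hom k & h = (k \o f)%VF)].

(* T is an Auslander-Reiten translate tau M = D Tr M; it is determined by M
   up to isomorphism. *)
Definition is_tau M T : Prop :=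
  exists2 L, is_transpose M L & iso_mod T (dual_mod L).

Definition tau_rigid M : Prop := exists2 T, is_tau M T & hom_zero M T.

Definition tau_rigid_pair M P : Prop :=
  [/\ projective_mod P, tau_rigid M & hom_zero P M].

Definition tau_tilting_pair M P : Prop :=
  tau_rigid_pair M P /\
  exists m p a, [/\ num_summands M m, num_summands P p,
                    num_summands (regmod A) a & (m + p = a)%N].

(* Full subcategories of mod A are plain predicates: the library type [set]
   lives in too small a universe to be applied to [rmod A]. *)
Definition mod_class : Type := rmod A -> Prop.

Definition same_class (C D : mod_class) : Prop := forall X, C X <-> D X.

Definition add_closure M : mod_class :=
  fun X => exists k, direct_summand (dsums (nseq k M)) X.

Definition Fac M : mod_class :=
  fun X => exists2 N, add_closure M N & quotient_of N X.

Definition torsion_class (C : mod_class) : Prop :=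
  (forall X Y, C X -> quotient_of X Y -> C Y) /\
  (forall X Y Z (f : 'Hom(X, Y)) (g : 'Hom(Y, Z)),
     short_exact f g -> C X -> C Z -> C Y).

Definition tors N : mod_class :=
  fun X => forall C : mod_class, torsion_class C -> C N -> C X.

Definition functorially_finite (C : mod_class) : Prop :=
  exists M, same_class C (Fac M).

Definition left_finite N : Prop := functorially_finite (tors N).

Section DimensionVectors.
Variables (n : nat) (S : 'I_n -> rmod A).

(* [comp_series X s] reads: X has a composition series whose successive factors are
   isomorphic to S i for i running through s, from the top factor down. *)
Inductive comp_series : rmod A -> seq 'I_n -> Prop :=
| comp_series_nil X : is_zero X -> comp_series X [::]
| comp_series_cons X Y i s (f : 'Hom(Y, X)) (g : 'Hom(X, S i)) :
    short_exact f g -> comp_series Y s -> comp_series X (i :: s).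

(* When S represents all simple modules a series exists, and by Jordan-Hoelder
   the multiplicities do not depend on the one that is chosen. *)
Definition comp_factors X : seq 'I_n := xget [::] (comp_series X).

Definition dimvec X : 'rV[nat]_n := \row_i count_mem i (comp_factors X).

Variable R : realType.

Definition newton_polytope U : set 'rV[R]_n :=
  smallest (@convex_set R 'rV[R]_n)
    [set v | exists2 X, quotient_of U X &
             v = map_mx (fun k => k%:R) (dimvec X)].

Definition pairing (delta : 'rV[R]_n) X : R :=
  \sum_(i < n) delta 0 i * (dimvec X 0 i)%:R.

Definition semistable_torsion (delta : 'rV[R]_n) : mod_class :=
  fun N => forall X, quotient_of N X -> 0 <= pairing delta X.

End DimensionVectors.

End ModuleCategory.

Arguments basic_algebra {K} A.
Arguments newton_polytope {K A n} S R U.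

(* Main.v *)
(* The Newton polytope of U decides on which side of a hyperplane through 0 the
   quotients of U lie, hence membership in every semistable torsion class.  So
   it suffices to exhibit torsion classes as semistable ones.  A presentation
   f : P1 -> P0 of M gives a functional delta = dim Hom(P0, -) - dim Hom(P1, -),
   linear in the dimension vector, which equals dim Hom(M, X) minus the
   dimension of the space of maps P1 -> X modulo those factoring through f;
   the latter vanishes exactly when Hom(X, tau M) = 0 if f is minimal.  If such
   functionals are nonnegative on Fac M and negative on the nonzero modules F
   with Hom(M, F) = 0, then the trace sequence of X shows that X lies in Fac M
   iff X is semistable.

   For a functorially finite torsion class one takes a minimal left
   approximation A -> T0 -> T1 -> 0 and the functional of T0 + T1.  For a
   tau-tilting pair (M, P) a bad F would be orthogonal to the g-vectors of the
   n indecomposable summands of M and P; these are linearly independent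
   because a relation between the dimensions of Hom(M_i, -) on Fac M forces
   its positive and negative parts to generate the same class, hence to share
   an indecomposable summand.  The remaining parts follow: a brick S receives
   only zero or surjective maps from the torsion class it generates; and if U and
   V are tau-rigid with Fac U = Fac V, then Hom(Fac U, tau U) and Hom(Fac U, tau V)
   vanish, and U and V share a split projective summand. *)

From HB Require Import structures.
Require Import Defs.
From mathcomp Require Import all_boot all_order all_algebra all_field.
From mathcomp Require Import boolp classical_sets reals convex.
From mathcomp Require Import interval_inference lra.

Set Implicit Arguments.
Unset Strict Implicit.
Unset Printing Implicit Defensive.

Import Order.TTheory GRing.Theory Num.Theory.
Local Open Scope ring_scope.

(** * Linear algebra *)

Section LinearAlgebra.
Variable K : fieldType.

(** A proof of linearity is bundled on the fly, so that no canonical linear structure has to be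
    declared for each auxiliary map. *)
Definition lfun_of (V W : vectType K) (f : V -> W) (lf : linear f) : 'Hom(V, W) :=
  linfun (HB.pack_for {linear V -> W} f (GRing.isLinear.Build K V W *:%R f lf)).

Lemma lfun_ofE (V W : vectType K) (f : V -> W) (lf : linear f) :
  lfun_of lf =1 f.
Proof. by move=> x; rewrite lfunE. Qed.

(** Dimensions are bounded by that of [V]. This replaces chain arguments below: it produces spans,
    maximal submodules, traces and approximations. *)
Lemma ex_dim_max (V : vectType K) (P : {vspace V} -> Prop) :
  (exists W, P W) ->
  exists2 W, P W & forall W', P W' -> (\dim W' <= \dim W)%N.
Proof.
move=> [W0 PW0]; pose Q d := `[< exists2 W, P W & \dim W = d >].
have exQ : exists d, Q d by exists (\dim W0); apply/asboolP; exists W0.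
have ubQ d : Q d -> (d <= \dim {:V})%N.
  by move=> /asboolP[W _ <-]; rewrite dimvS ?subvf.
case: (ex_maxnP exQ ubQ) => d /asboolP[W PW dW] dmax; exists W => // W' PW'.
by rewrite dW dmax //; apply/asboolP; exists W'.
Qed.

(** Take a subspace of largest dimension inside [P]; adding the line through a further [v] with
    [P v] stays inside [P], so [v] was already there. *)
Lemma vspace_of_pred (V : vectType K) (P : V -> Prop) :
    P 0 -> (forall k u v, P u -> P v -> P (k *: u + v)) ->
  exists W : {vspace V}, forall v, v \in W <-> P v.
Proof.
move=> P0 Plin.
have [|W PW Wmax] := @ex_dim_max V (fun W => forall v, v \in W -> P v).
  by exists 0%VS => v; rewrite memv0 => /eqP ->.
exists W => v; split=> [|Pv]; first exact: PW.
have /Wmax dle : forall u, u \in (W + <[v]>)%VS -> P u.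
  move=> _ /memv_addP[w wW [_ /vlineP[k ->] ->]].
  by rewrite addrC; apply: Plin => //; apply: PW.
have -> : W = (W + <[v]>)%VS by apply/eqP; rewrite eqEdim addvSl.
by apply: (subvP (addvSr _ _)); apply: memv_line.
Qed.

Lemma limg_fullP (V W : vectType K) (f : 'Hom(V, W)) :
  limg f = fullv <-> forall y, exists x, y = f x.
Proof.
split=> [fs y|fs].
  have /memv_imgP[x _ ->] : y \in limg f by rewrite fs memvf.
  by exists x.
by apply/vspaceP => y; rewrite memvf; have [x ->] := fs y; rewrite memv_img ?memvf.
Qed.

Lemma memv_limg (V W : vectType K) (f : 'Hom(V, W)) x : f x \in limg f.
Proof. by rewrite memv_img ?memvf. Qed.

Lemma lker0_inj (V W : vectType K) (f : 'Hom(V, W)) : lker f = 0%VS <-> injective f.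
Proof. by split=> [/eqP/lker0P|/lker0P/eqP]. Qed.

(** The quotient is realised on the complement of [W], with the projection along [W]. *)
Lemma quotient_vect (V : vectType K) (W : {vspace V}) :
  exists (T : vectType K) (p : 'Hom(V, T)), limg p = fullv /\ lker p = W.
Proof.
pose q := daddv_pi (W^C)%VS W.
pose p : 'Hom(V, subvs_of (W^C)%VS) := (linfun (vsproj _) \o q)%VF.
have WC0 : (W^C :&: W = 0)%VS by rewrite capvC capv_compl.
have pE x : vsval (p x) = q x by rewrite comp_lfunE lfunE /= vsprojK ?memv_pi.
exists _, p; split.
  apply/limg_fullP => y; exists (vsval y); apply: val_inj; rewrite /= pE.
  by rewrite daddv_pi_id ?subvsP.
apply/vspaceP => x; rewrite memv_ker.
have -> : (p x == 0) = (q x == 0) by rewrite -(inj_eq val_inj) /= pE.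
have xE : q x + daddv_pi W (W^C)%VS x = x.
  by apply: daddv_pi_add; rewrite ?WC0 // addvC addv_complf memvf.
apply/eqP/idP => [q0|xW]; first by rewrite -xE q0 add0r memv_pi.
have : q x \in (W^C :&: W)%VS.
  rewrite memv_cap memv_pi /= -[q x](addrK (daddv_pi W (W^C)%VS x)) xE.
  by rewrite memvB ?memv_pi.
by rewrite WC0 memv0 => /eqP.
Qed.

(** Some coordinate of the class of [v] modulo [W] is nonzero. *)
Lemma separating_functional (V : vectType K) (W : {vspace V}) v : v \notin W ->
  exists2 phi : 'Hom(V, K^o), forall w, w \in W -> phi w = 0 & phi v != 0.
Proof.
move=> nWv; have [T [p [_ kp]]] := quotient_vect W.
have pv0 : p v != 0 by rewrite -memv_ker kp.
have [i ci] : exists i, coord (vbasis fullv) i (p v) != 0.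
  apply: contrapT => nc; move/eqP: pv0; apply.
  rewrite [p v](coord_vbasis (memvf _)) big1 // => i _.
  suff -> : coord (vbasis fullv) i (p v) = 0 by rewrite scale0r.
  by apply/eqP/negPn/negP => ci; apply: nc; exists i.
have lphi : linear (fun w => coord (vbasis fullv) i (p w) : K^o).
  by move=> k x y; rewrite !linearP.
exists (lfun_of lphi) => [w|]; rewrite lfun_ofE // -kp memv_ker => /eqP ->.
by rewrite linear0.
Qed.

(** A preimage inside [H] is chosen linearly: a pseudo-inverse of [pi \o projv H], followed by the
    projection onto [H]. *)
Lemma linear_section (V L : vectType K) (pi : 'Hom(V, L)) (H : {vspace V}) :
  (pi @: H)%VS = fullv ->
  exists s : 'Hom(L, V), forall l, s l \in H /\ pi (s l) = l.
Proof.
move=> piH; pose q := (pi \o projv H)%VF.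
have qf : limg q = fullv by rewrite limg_comp limg_proj.
exists (projv H \o q^-1)%VF => l; rewrite comp_lfunE memv_proj; split=> //.
by rewrite -comp_lfunE limg_lfunVK // qf memvf.
Qed.


Lemma comp_lfun_sumr (U V W : vectType K) (I : Type) (r : seq I)
    (g : 'Hom(V, W)) (F : I -> 'Hom(U, V)) :
  (g \o \sum_(i <- r) F i = \sum_(i <- r) (g \o F i))%VF.
Proof. by apply: (big_morph (fun f => g \o f)%VF) => [f f'|]; rewrite (comp_lfunDr, comp_lfun0r). Qed.

Lemma comp_lfun_suml (U V W : vectType K) (I : Type) (r : seq I)
    (F : I -> 'Hom(V, W)) (g : 'Hom(U, V)) :
  ((\sum_(i <- r) F i) \o g = \sum_(i <- r) (F i \o g))%VF.
Proof. by apply: (big_morph (fun f => f \o g)%VF) => [f f'|]; rewrite (comp_lfunDl, comp_lfun0l). Qed.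

End LinearAlgebra.

(** * Newton polytopes and semistable torsion classes *)

Section Polytope.
Variables (R : realType) (n : nat).

Lemma halfspace_convex (delta : 'rV[R]_n) :
  @convex_set R 'rV[R]_n [set v | 0 <= \sum_(i < n) delta 0 i * v 0 i]%classic.
Proof.
move=> x y l /set_mem /= hx /set_mem /= hy; apply/mem_set => /=.
have -> : \sum_(i < n) delta 0 i * (conv l x y : 'rV[R]_n) 0 i =
    l%:num * (\sum_(i < n) delta 0 i * x 0 i) + (1 - l%:num) * (\sum_(i < n) delta 0 i * y 0 i).
  rewrite !mulr_sumr -big_split; apply: eq_bigr => i _ /=.
  by rewrite !mxE mulrDr !(mulrCA (delta 0 i)).
by rewrite addr_ge0 ?mulr_ge0 // ?ge0 // subr_ge0 le1.
Qed.

Variables (K : fieldType) (A : falgType K) (S : 'I_n -> rmod A).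

Lemma pairing_map_mx (delta : 'rV[R]_n) X :
  pairing S delta X = \sum_(i < n) delta 0 i * (map_mx (fun k => k%:R) (dimvec S X)) 0 i.
Proof. by apply: eq_bigr => i _; congr (_ * _); rewrite [RHS]mxE. Qed.

(** A closed half-space through 0 is convex, so it contains the polytope of [U] once it contains the
    dimension vectors of the quotients of [U]; those of [V] lie in that polytope. *)
Lemma semistable_newton U V (delta : 'rV[R]_n) :
  (newton_polytope S R V `<=` newton_polytope S R U)%classic ->
  semistable_torsion S delta U -> semistable_torsion S delta V.
Proof.
move=> sub sU X qX; rewrite pairing_map_mx.
have sub_half : (newton_polytope S R U `<=`
    [set v | 0 <= \sum_(i < n) delta 0 i * v 0 i])%classic.
  apply: smallest_sub; first exact: halfspace_convex.
  by move=> _ [Y qY ->] /=; rewrite -pairing_map_mx; apply: sU.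
by apply: sub_half; apply: sub; apply: sub_gen_smallest; exists X.
Qed.

End Polytope.

Section Modules.
Variables (K : fieldType) (A : falgType K).
Implicit Types M N P Q S T U V X Y Z F : rmod A.

(** * Modules and homomorphisms *)

Definition orbit_map X (x : X) : 'Hom(regmod A, X) := lfun_of (ract_linearr x).

Lemma orbit_mapE X (x : X) (a : A) : orbit_map x a = ract x a.
Proof. exact: lfun_ofE. Qed.

Definition ract_lfun X (a : A) : 'End(X) := lfun_of (@ract_linearl _ _ X a).

Lemma ract_lfunE X (a : A) (x : X) : ract_lfun X a x = ract x a.
Proof. exact: lfun_ofE. Qed.

Lemma ractDl X (x y : X) a : ract (x + y) a = ract x a + ract y a.
Proof. by rewrite -!ract_lfunE linearD. Qed.
Lemma ractBl X (x y : X) a : ract (x - y) a = ract x a - ract y a.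
Proof. by rewrite -!ract_lfunE linearB. Qed.
Lemma ractZl X k (x : X) a : ract (k *: x) a = k *: ract x a.
Proof. by rewrite -!ract_lfunE linearZ. Qed.
Lemma ract0l X a : ract (0 : X) a = 0.
Proof. by rewrite -ract_lfunE linear0. Qed.
Lemma ractDr X (x : X) a b : ract x (a + b) = ract x a + ract x b.
Proof. by rewrite -!orbit_mapE linearD. Qed.
Lemma ractZr X (x : X) k a : ract x (k *: a) = k *: ract x a.
Proof. by rewrite -!orbit_mapE linearZ. Qed.

Lemma is_hom_orbit X (x : X) : is_hom (orbit_map x).
Proof. by move=> b a; rewrite !orbit_mapE -ractM. Qed.

Lemma is_hom_id X : is_hom (\1%VF : 'End(X)).
Proof. by move=> x a; rewrite !id_lfunE. Qed.
Lemma is_hom0 X Y : is_hom (0 : 'Hom(X, Y)).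
Proof. by move=> x a; rewrite !zero_lfunE ract0l. Qed.
Lemma is_hom_comp X Y Z (g : 'Hom(Y, Z)) (f : 'Hom(X, Y)) :
  is_hom g -> is_hom f -> is_hom (g \o f)%VF.
Proof. by move=> hg hf x a; rewrite !comp_lfunE hf hg. Qed.
Lemma is_homP X Y k (f g : 'Hom(X, Y)) : is_hom f -> is_hom g -> is_hom (k *: f + g).
Proof.
by move=> hf hg x a; rewrite !add_lfunE !scale_lfunE hf hg ractDl ractZl.
Qed.
Lemma is_homD X Y (f g : 'Hom(X, Y)) : is_hom f -> is_hom g -> is_hom (f + g).
Proof. by move=> hf hg; rewrite -[f]scale1r; apply: is_homP. Qed.
Lemma is_homZ X Y k (f : 'Hom(X, Y)) : is_hom f -> is_hom (k *: f).
Proof. by move=> hf; rewrite -[k *: f]addr0; apply: is_homP => //; apply: is_hom0. Qed.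
Lemma is_homN X Y (f : 'Hom(X, Y)) : is_hom f -> is_hom (- f).
Proof. by move=> hf; rewrite -scaleN1r; apply: is_homZ. Qed.
Lemma is_homB X Y (f g : 'Hom(X, Y)) : is_hom f -> is_hom g -> is_hom (f - g).
Proof. by move=> hf hg; apply: is_homD => //; apply: is_homN. Qed.
Hint Resolve is_hom_id is_hom0 is_hom_comp is_homD is_homZ is_homN is_homB
  is_hom_orbit : core.

Lemma homv_subproof X Y :
  exists H : {vspace 'Hom(X, Y)}, forall f, f \in H <-> is_hom f.
Proof. by apply: vspace_of_pred => //; apply: is_homP. Qed.
(** Since [is_hom] is only a predicate, the subspace it cuts out is chosen classically, which gives
    access to its dimension. *)
Definition homv X Y : {vspace 'Hom(X, Y)} := projT1 (cid (homv_subproof X Y)).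
Lemma homvP X Y (f : 'Hom(X, Y)) : f \in homv X Y <-> is_hom f.
Proof. exact: (projT2 (cid (homv_subproof X Y))). Qed.
Definition dimHom X Y : nat := \dim (homv X Y).

Lemma is_submod_limg X Y (f : 'Hom(X, Y)) : is_hom f -> is_submod (limg f).
Proof. by move=> hf _ a /memv_imgP[x _ ->]; rewrite -hf memv_limg. Qed.
Lemma is_submod_lker X Y (f : 'Hom(X, Y)) : is_hom f -> is_submod (lker f).
Proof. by move=> hf x a; rewrite !memv_ker hf => /eqP ->; rewrite ract0l. Qed.
Lemma is_submod_add X (U V : {vspace X}) :
  is_submod U -> is_submod V -> is_submod (U + V)%VS.
Proof.
move=> sU sV _ a /memv_addP[u uU [v vV ->]].
by rewrite ractDl memv_add ?sU ?sV.
Qed.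
Lemma is_submod_img X Y (f : 'Hom(X, Y)) (U : {vspace X}) :
  is_hom f -> is_submod U -> is_submod (f @: U)%VS.
Proof. by move=> hf sU _ a /memv_imgP[x xU ->]; rewrite -hf memv_img ?sU. Qed.
Lemma is_submod0 X : is_submod (0%VS : {vspace X}).
Proof. by move=> x a; rewrite !memv0 => /eqP ->; rewrite ract0l. Qed.
Lemma is_submodf X : is_submod (fullv : {vspace X}).
Proof. by move=> x a _; rewrite memvf. Qed.
Hint Resolve is_submod_limg is_submod_lker is_submod0 is_submodf is_submod_add : core.

Lemma submodule_exists X (W : {vspace X}) : is_submod W ->
  exists Y (i : 'Hom(Y, X)), [/\ is_hom i, mono i & limg i = W].
Proof.
move=> sW.
pose act (u : subvs_of W) (a : A) : subvs_of W := vsproj W (ract (vsval u) a).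
have actE u a : vsval (act u a) = ract (vsval u) a by rewrite vsprojK ?sW ?subvsP.
have l1 a : linear (act^~ a).
  by move=> k x y; apply: val_inj; rewrite /= !actE /= ractDl ractZl.
have l2 u : linear (act u).
  by move=> k x y; apply: val_inj; rewrite /= !actE /= ractDr ractZr.
have a1 u : act u 1 = u by apply: val_inj; rewrite /= actE ract1.
have aM u a b : act u (a * b) = act (act u a) b.
  by apply: val_inj; rewrite /= !actE ractM.
pose Y := RMod l1 l2 a1 aM; pose i : 'Hom(Y, X) := linfun (@vsval _ _ W).
have iE u : i u = vsval u by rewrite lfunE.
exists Y, i; split.
- by move=> x a; rewrite !iE -actE.
- by apply/lker0_inj => x y; rewrite !iE => /val_inj.
- apply/vspaceP => x; apply/memv_imgP/idP => [[y _ ->]|xW].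
    by rewrite iE subvsP.
  by exists (Subvs xW); rewrite ?memvf // iE.
Qed.

Lemma quotient_exists X (W : {vspace X}) : is_submod W ->
  exists Q (p : 'Hom(X, Q)), [/\ is_hom p, epi p & lker p = W].
Proof.
move=> sW; have [T [p [ps kp]]] := quotient_vect W.
pose act (t : T) (a : A) : T := p (ract ((p^-1)%VF t) a).
have pV t : p ((p^-1)%VF t) = t by rewrite limg_lfunVK // ps memvf.
(* The action does not depend on the preimage: two preimages differ by an element of [W], which is
   stable. *)
have pact x a : act (p x) a = p (ract x a).
  apply/eqP; rewrite -subr_eq0 -linearB /= -ractBl -memv_ker kp sW // -kp memv_ker.
  by rewrite linearB /= pV subrr.
have l1 a : linear (act^~ a).
  by move=> k x y; rewrite /act linearP ractDl ractZl linearP.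
have l2 u : linear (act u).
  by move=> k x y; rewrite /act ractDr ractZr linearP.
have a1 u : act u 1 = u by rewrite /act ract1 pV.
have aM u a b : act u (a * b) = act (act u a) b by rewrite -[u]pV !pact ractM.
by exists (RMod l1 l2 a1 aM), p; split=> // x a /=; rewrite -pact.
Qed.

Lemma factor_epi X Q Y (p : 'Hom(X, Q)) (f : 'Hom(X, Y)) :
    is_hom p -> epi p -> is_hom f -> (lker p <= lker f)%VS ->
  exists2 g : 'Hom(Q, Y), is_hom g & (g \o p)%VF = f.
Proof.
move=> hp ep hf kpf; pose g := (f \o p^-1)%VF.
have gp x : g (p x) = f x.
  rewrite comp_lfunE; apply/eqP; rewrite -subr_eq0 -linearB -memv_ker.
  apply: (subvP kpf); rewrite memv_ker linearB /= limg_lfunVK ?subrr //.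
  exact: memv_limg.
exists g; last by apply/lfunP => x; rewrite comp_lfunE gp.
by move=> y a; have [x ->] := (limg_fullP p).1 ep y; rewrite -hp !gp hf.
Qed.

Lemma factor_mono Z Y X (i : 'Hom(Y, X)) (f : 'Hom(Z, X)) :
    is_hom i -> mono i -> is_hom f -> (limg f <= limg i)%VS ->
  exists2 g : 'Hom(Z, Y), is_hom g & (i \o g)%VF = f.
Proof.
move=> hi mi hf fi; pose g := (i^-1 \o f)%VF.
have ig x : i (g x) = f x.
  by rewrite comp_lfunE limg_lfunVK //; apply: (subvP fi); apply: memv_limg.
exists g; last by apply/lfunP => x; rewrite comp_lfunE ig.
by move=> z a; apply: ((lker0_inj i).1 mi); rewrite hi !ig hf.
Qed.

Lemma mono_dim_epi X Y (f : 'Hom(X, Y)) :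
  mono f -> (\dim {:Y} <= \dim {:X})%N -> epi f.
Proof.
move=> mf le; apply/eqP; rewrite eqEdim subvf /= limg_dim_eq //.
by rewrite mf capv0.
Qed.

Lemma epi_dim_mono X Y (f : 'Hom(X, Y)) :
  epi f -> (\dim {:X} <= \dim {:Y})%N -> mono f.
Proof.
move=> ef le; apply/eqP; rewrite -dimv_eq0 -leqn0.
have := limg_ker_dim f fullv; rewrite capfv ef => E.
by rewrite -(leq_add2r (\dim {:Y})) E.
Qed.

Lemma hom_inverse X Y (f : 'Hom(X, Y)) : is_hom f -> mono f -> epi f ->
  exists g : 'Hom(Y, X), [/\ is_hom g, (g \o f)%VF = \1%VF & (f \o g)%VF = \1%VF].
Proof.
move=> hf mf ef; have [|g hg gf] := factor_epi hf ef (@is_hom_id X).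
  by rewrite mf sub0v.
exists g; split=> //; apply/lfunP => y; have [x ->] := (limg_fullP f).1 ef y.
by rewrite -[in LHS]comp_lfunE -comp_lfunA gf comp_lfun1r id_lfunE.
Qed.

Lemma iso_refl X : iso_mod X X.
Proof.
exists \1%VF; split=> //; last by rewrite /epi lim1g.
by apply/lker0_inj => x y; rewrite !id_lfunE.
Qed.

Lemma iso_mod_inv X Y (f : 'Hom(X, Y)) (g : 'Hom(Y, X)) :
  is_hom f -> (g \o f)%VF = \1%VF -> (f \o g)%VF = \1%VF -> iso_mod X Y.
Proof.
move=> hf gf fg; exists f; split=> //.
  apply/lker0_inj => x y /(congr1 g).
  by rewrite -!comp_lfunE gf !id_lfunE.
by apply/limg_fullP => y; exists (g y); rewrite -comp_lfunE fg id_lfunE.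
Qed.

Lemma iso_modP X Y : iso_mod X Y ->
  exists (f : 'Hom(X, Y)) (g : 'Hom(Y, X)),
    [/\ is_hom f, is_hom g, (g \o f)%VF = \1%VF & (f \o g)%VF = \1%VF].
Proof.
by move=> [f [hf mf ef]]; have [g [hg gf fg]] := hom_inverse hf mf ef; exists f, g.
Qed.

Lemma iso_sym X Y : iso_mod X Y -> iso_mod Y X.
Proof. by move=> /iso_modP[f [g [hf hg gf fg]]]; apply: (iso_mod_inv hg fg gf). Qed.

Lemma iso_trans X Y Z : iso_mod X Y -> iso_mod Y Z -> iso_mod X Z.
Proof.
move=> /iso_modP[f [g [hf hg gf fg]]] /iso_modP[f' [g' [hf' hg' gf' fg']]].
apply: (@iso_mod_inv _ _ (f' \o f)%VF (g \o g')%VF); first by auto.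
  by rewrite comp_lfunA -(comp_lfunA g) gf' comp_lfun1r.
by rewrite comp_lfunA -(comp_lfunA f') fg comp_lfun1r.
Qed.

Lemma is_zeroP X : is_zero X <-> \dim {:X} = 0%N.
Proof.
split=> [zX|/eqP].
  apply/eqP; rewrite dimv_eq0; apply/eqP/vspaceP => x.
  by rewrite (zX x) !mem0v.
by rewrite dimv_eq0 => /eqP E x; apply/eqP; rewrite -memv0 -E memvf.
Qed.

Lemma not_zeroP X : ~ is_zero X <-> exists x : X, x != 0.
Proof.
split=> [nz|[x nx] zX]; last by rewrite (zX x) eqxx in nx.
apply: contrapT => nex; apply: nz => x; apply/eqP/negPn/negP => nx.
by apply: nex; exists x.
Qed.

(** * Direct sums and retracts *)

Section DirectSumMaps.
Variables X Y : rmod A.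

Fact dinl_linear : linear (fun x : X => (x, 0) : dsum X Y).
Proof. by move=> k x y; congr pair; rewrite /= scaler0 addr0. Qed.
Fact dinr_linear : linear (fun y : Y => (0, y) : dsum X Y).
Proof. by move=> k x y; congr pair; rewrite /= scaler0 addr0. Qed.
Fact dfst_linear : linear (fun u : dsum X Y => u.1 : X).
Proof. by move=> k [? ?] [? ?]. Qed.
Fact dsnd_linear : linear (fun u : dsum X Y => u.2 : Y).
Proof. by move=> k [? ?] [? ?]. Qed.

Definition dinl : 'Hom(X, dsum X Y) := lfun_of dinl_linear.
Definition dinr : 'Hom(Y, dsum X Y) := lfun_of dinr_linear.
Definition dfst : 'Hom(dsum X Y, X) := lfun_of dfst_linear.
Definition dsnd : 'Hom(dsum X Y, Y) := lfun_of dsnd_linear.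

Lemma dinlE x : dinl x = (x, 0). Proof. exact: lfun_ofE. Qed.
Lemma dinrE y : dinr y = (0, y). Proof. exact: lfun_ofE. Qed.
Lemma dfstE u : dfst u = u.1. Proof. exact: lfun_ofE. Qed.
Lemma dsndE u : dsnd u = u.2. Proof. exact: lfun_ofE. Qed.

Lemma is_hom_dinl : is_hom dinl.
Proof. by move=> x a; rewrite !dinlE; congr pair; rewrite ract0l. Qed.
Lemma is_hom_dinr : is_hom dinr.
Proof. by move=> x a; rewrite !dinrE; congr pair; rewrite ract0l. Qed.
Lemma is_hom_dfst : is_hom dfst.
Proof. by move=> u a; rewrite !dfstE. Qed.
Lemma is_hom_dsnd : is_hom dsnd.
Proof. by move=> u a; rewrite !dsndE. Qed.

Lemma dfst_dinl : (dfst \o dinl = \1)%VF.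
Proof. by apply/lfunP => x; rewrite comp_lfunE dinlE dfstE id_lfunE. Qed.
Lemma dsnd_dinr : (dsnd \o dinr = \1)%VF.
Proof. by apply/lfunP => x; rewrite comp_lfunE dinrE dsndE id_lfunE. Qed.
Lemma dsum_id : ((dinl \o dfst) + (dinr \o dsnd) = \1)%VF.
Proof.
apply/lfunP => -[x y]; rewrite add_lfunE !comp_lfunE id_lfunE dfstE dsndE dinlE dinrE /=.
by congr pair; rewrite /= ?addr0 ?add0r.
Qed.

Definition copair Z (f : 'Hom(X, Z)) (g : 'Hom(Y, Z)) : 'Hom(dsum X Y, Z) :=
  ((f \o dfst) + (g \o dsnd))%VF.

Lemma copairE Z (f : 'Hom(X, Z)) (g : 'Hom(Y, Z)) x y :
  copair f g (x, y) = f x + g y.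
Proof. by rewrite add_lfunE !comp_lfunE dfstE dsndE. Qed.

Lemma is_hom_copair Z (f : 'Hom(X, Z)) (g : 'Hom(Y, Z)) :
  is_hom f -> is_hom g -> is_hom (copair f g).
Proof.
by move=> hf hg; apply: is_homD; apply: is_hom_comp; auto using is_hom_dfst, is_hom_dsnd.
Qed.

Lemma limg_copair Z (f : 'Hom(X, Z)) (g : 'Hom(Y, Z)) :
  limg (copair f g) = (limg f + limg g)%VS.
Proof.
apply/eqP; rewrite eqEsubv subv_add; apply/and3P; split; apply/subvP => _ /memv_imgP[u _ ->].
- by case: u => x y; rewrite copairE memv_add ?memv_limg.
- by rewrite -[f u]addr0 -(linear0 g) -copairE memv_limg.
- by rewrite -[g u]add0r -(linear0 f) -copairE memv_limg.
Qed.

End DirectSumMaps.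
Hint Resolve is_hom_dinl is_hom_dinr is_hom_dfst is_hom_dsnd is_hom_copair : core.

Lemma copair_inl X Y Z (f : 'Hom(X, Z)) (g : 'Hom(Y, Z)) :
  (copair f g \o dinl X Y = f)%VF.
Proof. by apply/lfunP => x; rewrite comp_lfunE dinlE copairE linear0 addr0. Qed.
Lemma copair_inr X Y Z (f : 'Hom(X, Z)) (g : 'Hom(Y, Z)) :
  (copair f g \o dinr X Y = g)%VF.
Proof. by apply/lfunP => x; rewrite comp_lfunE dinrE copairE linear0 add0r. Qed.

Lemma dsum_ext X Y Z (f g : 'Hom(dsum X Y, Z)) :
  (f \o dinl X Y = g \o dinl X Y)%VF -> (f \o dinr X Y = g \o dinr X Y)%VF -> f = g.
Proof.
by move=> l r; rewrite -[f]comp_lfun1r -[g]comp_lfun1r -dsum_id !comp_lfunDr !comp_lfunA l r.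
Qed.

(** The form of [direct_summand] that composes directly; [direct_summandP] proves the
    equivalence. *)
Definition retract T X : Prop :=
  exists (i : 'Hom(T, X)) (r : 'Hom(X, T)), [/\ is_hom i, is_hom r & (r \o i = \1)%VF].

Lemma section_mono T X (i : 'Hom(T, X)) (r : 'Hom(X, T)) : (r \o i = \1)%VF -> mono i.
Proof.
move=> ri; apply/lker0_inj => x y /(congr1 r).
by rewrite -!comp_lfunE ri !id_lfunE.
Qed.

Lemma section_epi T X (i : 'Hom(T, X)) (r : 'Hom(X, T)) : (r \o i = \1)%VF -> epi r.
Proof. by move=> ri; apply/limg_fullP => y; exists (i y); rewrite -comp_lfunE ri id_lfunE. Qed.

Lemma comp_lfun_epi X Y Z (g : 'Hom(Y, Z)) (f : 'Hom(X, Y)) :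
  epi g -> epi f -> epi (g \o f)%VF.
Proof. by move=> eg ef; rewrite /epi limg_comp ef. Qed.

Lemma retract_trans X Y Z : retract X Y -> retract Y Z -> retract X Z.
Proof.
move=> [i [r [hi hr ri]]] [i' [r' [hi' hr' ri']]].
exists (i' \o i)%VF, (r \o r')%VF; split; auto.
by rewrite comp_lfunA -(comp_lfunA r) ri' comp_lfun1r.
Qed.

Lemma iso_retract X Y : iso_mod X Y -> retract X Y.
Proof. by move=> /iso_modP[f [g [hf hg gf _]]]; exists f, g. Qed.

Lemma retract_inl X Y : retract X (dsum X Y).
Proof. by exists (dinl X Y), (dfst X Y); split; rewrite ?dfst_dinl. Qed.
Lemma retract_inr X Y : retract Y (dsum X Y).
Proof. by exists (dinr X Y), (dsnd X Y); split; rewrite ?dsnd_dinr. Qed.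

Lemma retract_quotient T X : retract T X -> quotient_of X T.
Proof. by move=> [i [r [_ hr /section_epi er]]]; exists r. Qed.

(** The complement is [lker r], and the projection onto it is [\1 - i \o r]. Its dimension is
    recorded so that a zero complement can be recognised. *)
Lemma retract_complement T X (i : 'Hom(T, X)) (r : 'Hom(X, T)) :
    is_hom i -> is_hom r -> (r \o i = \1)%VF ->
  exists2 Z, iso_mod X (dsum T Z) & \dim {:Z} = \dim (lker r).
Proof.
move=> hi hr ri; have [Z [j [hj mj jZ]]] := submodule_exists (is_submod_lker hr).
have riE t : r (i t) = t by rewrite -comp_lfunE ri id_lfunE.
have [||q hq jq] := @factor_mono X Z X j (\1 - (i \o r))%VF hj mj; auto.
  apply/subvP => _ /memv_imgP[x _ ->]; rewrite jZ memv_ker !lfun_simp /=.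
  by rewrite linearB /= riE subrr.
have jqE x : j (q x) = x - i (r x) by rewrite -comp_lfunE jq !lfun_simp.
exists Z; last first.
  by rewrite -jZ limg_dim_eq // mj capv0.
apply: (@iso_mod_inv _ _ ((dinl T Z \o r) + (dinr T Z \o q))%VF (copair i j)); auto.
  apply/lfunP => x; rewrite comp_lfunE add_lfunE !comp_lfunE dinlE dinrE id_lfunE.
  have -> : ((r x, 0) : dsum T Z) + (0, q x) = (r x, q x).
    by congr pair; rewrite /= ?addr0 ?add0r.
  by rewrite copairE jqE addrC subrK.
have rj z : r (j z) = 0 by apply/eqP; rewrite -memv_ker -jZ memv_limg.
apply/lfunP => -[t z]; rewrite comp_lfunE copairE id_lfunE add_lfunE !comp_lfunE dinlE dinrE.
have -> : r (i t + j z) = t by rewrite linearD /= riE rj addr0.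
have -> : q (i t + j z) = z.
  apply: ((lker0_inj j).1 mj); rewrite jqE [r _]linearD /= riE rj addr0.
  by rewrite addrC addrA addNr add0r.
by congr pair; rewrite /= ?addr0 ?add0r.
Qed.

Lemma direct_summandP X T : direct_summand X T <-> retract T X.
Proof.
split=> [[Z XTZ]|[i [r [hi hr ri]]]].
  exact: retract_trans (retract_inl T Z) (iso_retract (iso_sym XTZ)).
by have [Z XTZ _] := retract_complement hi hr ri; exists Z.
Qed.

Lemma retract_dim_iso T X : retract T X -> (\dim {:X} <= \dim {:T})%N -> iso_mod T X.
Proof.
move=> [i [r [hi hr ri]]] le; exists i; split=> //; first exact: section_mono ri.
exact: mono_dim_epi (section_mono ri) le.
Qed.

Lemma retract_dim T X : retract T X -> (\dim {:T} <= \dim {:X})%N.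
Proof.
move=> [i [r [_ _ /section_mono mi]]]; have := limg_dim_eq (f := i) (U := fullv).
by rewrite mi capv0 => <- //; rewrite dimvS ?subvf.
Qed.

Lemma retract_indecomposable T X :
  ~ is_zero T -> indecomposable X -> retract T X -> iso_mod T X.
Proof.
move=> nzT [_ iX] rTX; have [i [r [hi hr ri]]] := rTX.
have [Z XTZ dZ] := retract_complement hi hr ri.
case: (iX _ _ XTZ) => [/nzT//|/is_zeroP]; rewrite dZ => /eqP; rewrite dimv_eq0 => /eqP kr0.
apply: retract_dim_iso => //.
by have := limg_ker_dim r fullv; rewrite capfv kr0 dimv0 (section_epi ri) add0n => <-.
Qed.

Lemma zero_mod_zero : is_zero (zero_mod A).
Proof. by move=> x; rewrite [x]thinmx0 [RHS]thinmx0. Qed.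

Lemma mono_eq0 X Y (f : 'Hom(X, Y)) x : mono f -> (f x == 0) = (x == 0).
Proof. by move=> mf; rewrite -memv_ker mf memv0. Qed.

(** * Fitting decomposition and local endomorphism rings *)

Section StablePower.
Variables (X : rmod A) (e : 'End(X)).
Hypothesis he : is_hom e.

Fixpoint lfun_iter (k : nat) : 'End(X) :=
  if k is k'.+1 then (e \o lfun_iter k')%VF else \1%VF.

Lemma is_hom_iter k : is_hom (lfun_iter k).
Proof. by elim: k => [|k IH] /=; auto. Qed.

Lemma lfun_iterD j k : (lfun_iter (j + k) = lfun_iter j \o lfun_iter k)%VF.
Proof. by elim: j => [|j IH]; rewrite ?comp_lfun1l // addSn /= IH comp_lfunA. Qed.

(** A positive exponent that minimises the rank works. Positivity is used later: it puts [lker e]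
    inside the kernel of the power, and the image of the power inside [limg e]. *)
Lemma iter_stable : exists2 k, (0 < k)%N &
  limg (lfun_iter k \o lfun_iter k) = limg (lfun_iter k).
Proof.
have sub j k : (limg (lfun_iter (j + k)) <= limg (lfun_iter j))%VS.
  by rewrite lfun_iterD limg_comp limgS ?subvf.
have [k kgt0 kmin] : exists2 k, (0 < k)%N &
    forall j, (\dim (limg (lfun_iter k)) <= \dim (limg (lfun_iter (k + j))))%N.
  pose Q d := `[< exists2 k, (0 < k)%N & \dim (limg (lfun_iter k)) = d >].
  have exQ : exists d, Q d by exists (\dim (limg (lfun_iter 1))); apply/asboolP; exists 1%N.
  case: (ex_minnP exQ) => d /asboolP[k k0 dk] dmin; exists k => // j.
  by rewrite dk dmin //; apply/asboolP; exists (k + j)%N; rewrite ?addn_gt0 ?k0.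
exists k => //; apply/eqP; rewrite -lfun_iterD eqEdim sub /=; exact: kmin.
Qed.

(* Fitting's lemma: [limg c] is a complement of [lker c] for [c] a high power of [e]. *)
Lemma fitting : exists k Y (i : 'Hom(Y, X)) (r : 'Hom(X, Y)),
  [/\ (0 < k)%N, is_hom i /\ is_hom r, (r \o i = \1)%VF, limg i = limg (lfun_iter k) &
      lker r = lker (lfun_iter k)].
Proof.
have [k k0 st] := iter_stable; set c := lfun_iter k in st *.
have hc : is_hom c := @is_hom_iter k.
have [Y [i [hi mi iY]]] := submodule_exists (is_submod_limg hc).
have [|c' hc' ic'] := factor_mono hi mi hc; first by rewrite iY.
have ec' : epi (c' \o i)%VF.
  apply/limg_fullP => y; have : i y \in limg (c \o c)%VF by rewrite st -iY memv_limg.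
  case/memv_imgP=> x _; rewrite comp_lfunE; have : c x \in limg i by rewrite iY memv_limg.
  case/memv_imgP=> y' _ -> E; exists y'; apply: ((lker0_inj i).1 mi).
  by rewrite E -ic' !comp_lfunE.
have mc' : mono (c' \o i)%VF by apply: epi_dim_mono.
have [g [hg gc' _]] := hom_inverse (is_hom_comp hc' hi) mc' ec'.
have mg : mono g.
  apply: epi_dim_mono => //; exact: section_epi gc'.
exists k, Y, i, (g \o c')%VF; split; auto; first by rewrite -comp_lfunA.
apply/vspaceP => x; rewrite !memv_ker -/c -ic' !comp_lfunE.
by rewrite (mono_eq0 _ mg) (mono_eq0 _ mi).
Qed.

End StablePower.

(** By Fitting, one of the image and the kernel of a power of [e] vanishes. If the image does, [e]
    is nilpotent and fixes no nonzero vector; if the kernel does, [e] is injective. *)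
Lemma indecomposable_local X (e : 'End(X)) : indecomposable X -> is_hom e ->
  (mono e) \/ (mono (\1 - e)%VF).
Proof.
move=> iX he; have [k [Y [i [r [k0 [hi hr] ri iY kr]]]]] := fitting he.
have [Z XYZ dZ] := retract_complement hi hr ri.
case: (iX.2 _ _ XYZ) => [zY|/is_zeroP zZ].
  right; apply/eqP; rewrite -subv0; apply/subvP => u.
  rewrite memv_ker !lfun_simp subr_eq0 memv0 => /eqP/esym eu.
  have eku m : lfun_iter e m u = u.
    by elim: m => [|m IH]; rewrite ?id_lfunE //= comp_lfunE IH.
  have : lfun_iter e k u \in limg i by rewrite iY memv_limg.
  by rewrite eku => /memv_imgP[y' _ ->]; rewrite (zY y') linear0 eqxx.
left; move/eqP: zZ; rewrite dZ kr dimv_eq0 => /eqP kc0.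
apply/eqP; rewrite -subv0 -kc0; case: k k0 {iY kr} kc0 => // k _ kc0.
apply/subvP => x; rewrite !memv_ker -addn1 lfun_iterD /= !lfun_simp.
by move=> /eqP ->; rewrite linear0.
Qed.

(** * Generation and projective covers *)

Lemma mono_comp_retract T Y (a : 'Hom(Y, T)) (b : 'Hom(T, Y)) :
  is_hom a -> is_hom b -> mono (a \o b)%VF -> retract T Y.
Proof.
move=> ha hb mab.
have [g [hg gab _]] := hom_inverse (is_hom_comp ha hb) mab (mono_dim_epi mab (leqnn _)).
by exists b, (g \o a)%VF; split; auto; rewrite -comp_lfunA.
Qed.

(** The identity of [T] is the sum of an endomorphism through [Y] and one through [Z]. By locality
    one of them is injective, hence invertible, so [T] splits off there. This is the uniqueness half
    of Krull-Schmidt in the form used below. *)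
Lemma indecomposable_retract_dsum T Y Z :
  indecomposable T -> retract T (dsum Y Z) -> retract T Y \/ retract T Z.
Proof.
move=> iT [i [r [hi hr ri]]].
pose e := ((r \o dinl Y Z) \o (dfst Y Z \o i))%VF.
have he : is_hom e by apply: is_hom_comp; auto.
have eC : (\1 - e = (r \o dinr Y Z) \o (dsnd Y Z \o i))%VF.
  apply/eqP; rewrite subr_eq addrC /e -!comp_lfunA -comp_lfunDr !comp_lfunA -comp_lfunDl.
  by rewrite dsum_id comp_lfun1l ri.
case: (indecomposable_local iT he) => m; [left|right; rewrite eC in m].
  by apply: mono_comp_retract m; auto.
by apply: mono_comp_retract m; auto.
Qed.

Lemma retract_is_zero T X : retract T X -> is_zero X -> is_zero T.
Proof. by move=> /retract_dim le /is_zeroP X0; apply/is_zeroP/eqP; rewrite -leqn0 -X0. Qed.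

Lemma indecomposable_retract_dsums (I : eqType) (N : I -> rmod A) (s : seq I) T :
  indecomposable T -> retract T (dsums [seq N i | i <- s]) ->
  exists2 i, i \in s & retract T (N i).
Proof.
move=> iT; elim: s => [|i s IH] /= rT.
  by case: iT.1; apply: retract_is_zero rT (@zero_mod_zero).
case: (indecomposable_retract_dsum iT rT) => [rTi|/IH[j js rTj]].
  by exists i; rewrite ?mem_head.
by exists j; rewrite // inE js orbT.
Qed.

Lemma retract_dsums (I : eqType) (N : I -> rmod A) (s : seq I) i :
  i \in s -> retract (N i) (dsums [seq N i | i <- s]).
Proof.
elim: s => // j s IH; rewrite inE => /predU1P[->|/IH r] /=; first exact: retract_inl.
exact: retract_trans r (retract_inr _ _).
Qed.

Lemma dim_dsum X Y : \dim {:dsum X Y} = (\dim {:X} + \dim {:Y})%N.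
Proof. by rewrite !dimvf. Qed.

Lemma exists_indecomposable_retract X :
  ~ is_zero X -> exists2 T, indecomposable T & retract T X.
Proof.
have [n] := ubnP (\dim {:X}); elim: n X => // n IH X ltn nzX.
have [iX|niX] := pselect (indecomposable X).
  by exists X => //; apply/iso_retract/iso_refl.
have [Y [Z [XYZ nzY nzZ]]] : exists Y Z, [/\ iso_mod X (dsum Y Z), ~ is_zero Y & ~ is_zero Z].
  apply: contrapT => nYZ; apply: niX; split=> // Y Z XYZ; apply: contrapT => /not_orP[nY nZ].
  by apply: nYZ; exists Y, Z.
have le : (\dim {:dsum Y Z} <= \dim {:X})%N by apply/retract_dim/iso_retract/iso_sym.
have [|T iT rT] := IH Y _ nzY.
  rewrite -ltnS; apply: leq_ltn_trans ltn; apply: leq_trans le; rewrite dim_dsum -addn1 leq_add2l lt0n.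
  by apply/eqP => /is_zeroP.
exists T => //; apply: retract_trans rT _; apply: retract_trans (retract_inl Y Z) _.
exact/iso_retract/iso_sym.
Qed.

(* [gen M X]: the images of the homomorphisms from [M] span [X]; this is the
   class [Fac M] (see [Fac_gen]), in a form that is easy to transport. *)
Definition gen M X : Prop :=
  forall W : {vspace X}, (forall g : 'Hom(M, X), is_hom g -> (limg g <= W)%VS) -> W = fullv.

Lemma gen_refl M : gen M M.
Proof.
move=> W /(_ \1%VF (@is_hom_id _)); rewrite lim1g => h.
by apply/eqP; rewrite eqEsubv subvf h.
Qed.

Lemma gen_quotient M X Y : gen M X -> quotient_of X Y -> gen M Y.
Proof.
move=> gMX [p [hp ep]] W hW.
have Wf : (p @^-1: W)%VS = fullv.
  apply: gMX => g hg; apply/subvP => _ /memv_imgP[m _ ->].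
  rewrite -memv_preim -comp_lfunE; apply: (subvP (hW _ (is_hom_comp hp hg))).
  exact: memv_limg.
apply/vspaceP => y; have [x ->] := (limg_fullP p).1 ep y.
by rewrite memv_preim Wf !memvf.
Qed.

Lemma gen_trans M N X : gen M N -> gen N X -> gen M X.
Proof.
move=> gMN gNX W hW; apply: gNX => g hg.
have Wf : (g @^-1: W)%VS = fullv.
  apply: gMN => h hh; apply/subvP => _ /memv_imgP[m _ ->].
  rewrite -memv_preim -comp_lfunE; apply: (subvP (hW _ (is_hom_comp hg hh))).
  exact: memv_limg.
by apply/subvP => _ /memv_imgP[m _ ->]; rewrite memv_preim Wf memvf.
Qed.

Lemma gen_retract T X : retract T X -> gen X T.
Proof. by move=> /retract_quotient; apply: gen_quotient; apply: gen_refl. Qed.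

Lemma gen_zero M X : is_zero X -> gen M X.
Proof. by move=> zX W _; apply/vspaceP => x; rewrite (zX x) !mem0v. Qed.

(** The lifting hypothesis is what the vanishing of Ext(M, X) would provide: a subspace [W] that
    contains all images contains [limg f], and by lifting it maps onto [Z]. *)
Lemma gen_extension M X Y Z (f : 'Hom(X, Y)) (g : 'Hom(Y, Z)) :
    short_exact f g -> gen M X -> gen M Z ->
    (forall h : 'Hom(M, Z), is_hom h ->
      exists2 h' : 'Hom(M, Y), is_hom h' & (g \o h')%VF = h) ->
  gen M Y.
Proof.
move=> [[hf hg] mf fg eg] gX gZ lift W hW.
have fW : (limg f <= W)%VS.
  have E : (f @^-1: W)%VS = fullv.
    apply: gX => h hh; apply/subvP => _ /memv_imgP[m _ ->].
    rewrite -memv_preim -comp_lfunE; apply: (subvP (hW _ (is_hom_comp hf hh))).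
    exact: memv_limg.
  by apply/subvP => _ /memv_imgP[m _ ->]; rewrite memv_preim E memvf.
have gW : (g @: W)%VS = fullv.
  by apply: gZ => h /lift[h' hh' <-]; rewrite limg_comp limgS ?hW.
apply/vspaceP => y; rewrite memvf; have : g y \in (g @: W)%VS by rewrite gW memvf.
case/memv_imgP=> w wW E; rewrite -[y](subrK w) memvD // (subvP fW) // fg memv_ker.
by rewrite linearB /= E subrr.
Qed.

Lemma short_exact_dsum X Y : short_exact (dinl X Y) (dsnd X Y).
Proof.
split; auto.
- exact: section_mono (dfst_dinl X Y).
- apply/vspaceP => -[x y]; rewrite memv_ker dsndE /=.
  apply/memv_imgP/eqP => [[z _]|->]; first by rewrite dinlE => -[].
  by exists x; rewrite ?memvf ?dinlE.
- exact: section_epi (dsnd_dinr X Y).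
Qed.

Lemma gen_dsum M X Y : gen M X -> gen M Y -> gen M (dsum X Y).
Proof.
move=> gX gY; apply: (gen_extension (short_exact_dsum X Y)) => // h hh.
by exists (dinr X Y \o h)%VF; auto; rewrite comp_lfunA dsnd_dinr comp_lfun1l.
Qed.

Lemma gen_dsums (I : eqType) (N : I -> rmod A) (s : seq I) M :
  (forall i, i \in s -> gen M (N i)) -> gen M (dsums [seq N i | i <- s]).
Proof.
elim: s => [_|i s IH gN] /=; first exact/gen_zero/zero_mod_zero.
apply: gen_dsum; first by apply: gN; rewrite mem_head.
by apply: IH => j js; apply: gN; rewrite inE js orbT.
Qed.

Lemma gen_nseq M X k : gen M X -> gen M (dsums (nseq k X)).
Proof.
move=> gX; have -> : nseq k X = [seq (fun=> X) i | i <- nseq k tt] by rewrite map_nseq.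
exact: gen_dsums.
Qed.

(** An image of largest dimension among maps from finite powers of [M] absorbs every further [g],
    since [copair g f] is again such a map. *)
Lemma trace_exists M X : exists k (f : 'Hom(dsums (nseq k M), X)),
  is_hom f /\ forall g : 'Hom(M, X), is_hom g -> (limg g <= limg f)%VS.
Proof.
have [|W [k [f hf <-]] Wmax] := @ex_dim_max _ X
    (fun W => exists k, exists2 f : 'Hom(dsums (nseq k M), X), is_hom f & limg f = W).
  exists 0%VS, 0%N, 0; first exact: is_hom0.
  by rewrite lim0g.
exists k, f; split=> // g hg.
have /Wmax le : exists k', exists2 f' : 'Hom(dsums (nseq k' M), X), is_hom f' &
    limg f' = (limg g + limg f)%VS.
  by exists k.+1, (copair g f); [exact: is_hom_copair|exact: limg_copair].
suff -> : limg f = (limg g + limg f)%VS by exact: addvSl.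
by apply/eqP; rewrite eqEdim addvSr.
Qed.

Lemma genP M X : gen M X <-> exists k, quotient_of (dsums (nseq k M)) X.
Proof.
split=> [gMX|[k]]; last by apply: gen_quotient; apply: gen_nseq; apply: gen_refl.
by have [k [f [hf fmax]]] := trace_exists M X; exists k, f; split=> //; apply: gMX.
Qed.

Lemma trace_submodule M X : exists Y (i : 'Hom(Y, X)),
  [/\ is_hom i, mono i, gen M Y & forall g : 'Hom(M, X), is_hom g -> (limg g <= limg i)%VS].
Proof.
have [k [f [hf fmax]]] := trace_exists M X.
have [Y [i [hi mi iY]]] := submodule_exists (is_submod_limg hf).
have [|p hp ip] := factor_mono hi mi hf; first by rewrite iY.
exists Y, i; split; rewrite ?iY //; apply/genP; exists k, p; split=> //.
apply/limg_fullP => y; have : i y \in limg f by rewrite -iY memv_limg.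
case/memv_imgP=> x _; rewrite -ip comp_lfunE => /((lker0_inj i).1 mi) ->.
by exists x.
Qed.

Lemma Fac_gen M X : Fac M X <-> gen M X.
Proof.
split=> [[N [k /direct_summandP rN] qX]|/genP[k qX]].
  apply: gen_quotient qX; apply: gen_quotient (retract_quotient rN).
  exact/gen_nseq/gen_refl.
by exists (dsums (nseq k M)) => //; exists k; apply/direct_summandP/iso_retract/iso_refl.
Qed.

(** * Projective modules and projective covers *)

Lemma projective_regmod : projective_mod (regmod A).
Proof.
move=> X Y p h hp ep hh; have [x hx] := (limg_fullP p).1 ep (h 1).
exists (orbit_map x) => //; apply/lfunP => a; rewrite comp_lfunE orbit_mapE hp -hx -hh.
by congr (h _); rewrite /= /reg_act mul1r.
Qed.

Lemma projective_zero P : is_zero P -> projective_mod P.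
Proof.
move=> zP X Y p h _ _ _; exists 0; first exact: is_hom0.
by apply/lfunP => x; rewrite (zP x) !linear0.
Qed.

Lemma projective_dsum P Q : projective_mod P -> projective_mod Q -> projective_mod (dsum P Q).
Proof.
move=> pP pQ X Y p h hp ep hh.
have [l hl E] := pP _ _ p (h \o dinl P Q)%VF hp ep (is_hom_comp hh (@is_hom_dinl _ _)).
have [l' hl' E'] := pQ _ _ p (h \o dinr P Q)%VF hp ep (is_hom_comp hh (@is_hom_dinr _ _)).
exists (copair l l'); first exact: is_hom_copair.
by apply: dsum_ext; rewrite -comp_lfunA ?copair_inl ?copair_inr.
Qed.

Lemma projective_nseq P k : projective_mod P -> projective_mod (dsums (nseq k P)).
Proof.
move=> pP; elim: k => [|k IH] /=; first exact/projective_zero/zero_mod_zero.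
exact: projective_dsum.
Qed.

Lemma projective_retract P Q : retract P Q -> projective_mod Q -> projective_mod P.
Proof.
move=> [i [r [hi hr ri]]] pQ X Y p h hp ep hh.
have [l hl E] := pQ _ _ p (h \o r)%VF hp ep (is_hom_comp hh hr).
exists (l \o i)%VF; auto.
by rewrite comp_lfunA -E -comp_lfunA ri comp_lfun1r.
Qed.

Lemma gen_regmod X : gen (regmod A) X.
Proof.
move=> W hW; apply/vspaceP => x; rewrite memvf.
apply: (subvP (hW _ (is_hom_orbit x))); rewrite -[x in x \in _]ract1 -orbit_mapE.
exact: memv_limg.
Qed.

Lemma split_epi_projective P X (p : 'Hom(X, P)) : projective_mod P -> is_hom p -> epi p ->
  exists2 s : 'Hom(P, X), is_hom s & (p \o s)%VF = \1%VF.
Proof. by move=> pP hp ep; have [s hs E] := pP _ _ p _ hp ep (@is_hom_id P); exists s. Qed.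

(** Take a projective [P] of least dimension mapping onto [X]. If [N + lker g] is all of [P],
    lifting [g] through [N] gives an endomorphism [e] with image in [N] and [g \o e = g]. By Fitting
    the image of a power of [e] is a summand of [P] that still maps onto [X]; minimality makes it
    all of [P], so [N] is too. *)
Lemma projective_cover_exists X : exists P (g : 'Hom(P, X)),
  [/\ projective_mod P, is_hom g, epi g & superfluous (lker g)].
Proof.
pose Q d := `[< exists P (g : 'Hom(P, X)),
  [/\ projective_mod P, is_hom g, epi g & \dim {:P} = d] >].
have exQ : exists d, Q d.
  have [k [g [hg eg]]] := (genP (regmod A) X).1 (@gen_regmod X).
  exists (\dim {:dsums (nseq k (regmod A))}); apply/asboolP; exists _, g; split=> //.
  exact/projective_nseq/projective_regmod.
case: (ex_minnP exQ) => d /asboolP[P [g [pP hg eg dP]]] dmin.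
exists P, g; split=> // N sN NP.
have [Y [i [hi mi iY]]] := submodule_exists sN.
have ei : epi (g \o i)%VF.
  apply/limg_fullP => x; have [y ->] := (limg_fullP g).1 eg x.
  have : y \in (N + lker g)%VS by rewrite NP memvf.
  case/memv_addP=> n nN [u]; rewrite memv_ker => /eqP gu ->.
  have /memv_imgP[z _ nz] : n \in limg i by rewrite iY.
  by exists z; rewrite comp_lfunE -nz linearD /= gu addr0.
have [l hl gl] := pP _ _ _ _ (is_hom_comp hg hi) ei hg.
pose e := (i \o l)%VF; have he : is_hom e by apply: is_hom_comp.
have ge k : (g \o lfun_iter e k)%VF = g.
  by elim: k => [|k IH] /=; rewrite ?comp_lfun1r // comp_lfunA /e comp_lfunA -gl.
have [k [Z [j [r [k0 [hj hr] rj jZ kr]]]]] := fitting he.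
have ejg : epi (g \o j)%VF.
  rewrite /epi limg_comp jZ -limg_comp ge; exact: eg.
have le : (d <= \dim {:Z})%N.
  apply: dmin; apply/asboolP; exists Z, (g \o j)%VF; split; auto.
  by apply: projective_retract pP; exists j, r.
have ej : epi j by apply: mono_dim_epi; [exact: section_mono rj|rewrite dP].
apply/eqP; rewrite eqEsubv subvf /= -ej jZ; case: k k0 {ge kr jZ} => // k _.
by rewrite /= /e -comp_lfunA limg_comp -iY limgS ?subvf.
Qed.

(** * Dimensions of Hom spaces *)

Fact postcomp_linear X Y Z (g : 'Hom(Y, Z)) : linear (fun f : 'Hom(X, Y) => (g \o f)%VF).
Proof. by move=> k f f'; rewrite comp_lfunDr comp_lfunZr. Qed.
Definition postcomp X Y Z (g : 'Hom(Y, Z)) : 'Hom('Hom(X, Y), 'Hom(X, Z)) :=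
  lfun_of (@postcomp_linear X Y Z g).
Fact precomp_linear X Y Z (f : 'Hom(X, Y)) : linear (fun g : 'Hom(Y, Z) => (g \o f)%VF).
Proof. by move=> k g g'; rewrite comp_lfunDl comp_lfunZl. Qed.
Definition precomp X Y Z (f : 'Hom(X, Y)) : 'Hom('Hom(Y, Z), 'Hom(X, Z)) :=
  lfun_of (@precomp_linear X Y Z f).

Lemma postcompE X Y Z (g : 'Hom(Y, Z)) (f : 'Hom(X, Y)) : postcomp X g f = (g \o f)%VF.
Proof. exact: lfun_ofE. Qed.
Lemma precompE X Y Z (g : 'Hom(Y, Z)) (f : 'Hom(X, Y)) : precomp Z f g = (g \o f)%VF.
Proof. exact: lfun_ofE. Qed.

Lemma dimHom_eq0 X Y : dimHom X Y = 0%N <-> hom_zero X Y.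
Proof.
split=> [/eqP|h0]; rewrite /dimHom.
  by rewrite dimv_eq0 => /eqP E f /homvP; rewrite E memv0 => /eqP.
apply/eqP; rewrite dimv_eq0 -subv0; apply/subvP => f /homvP/h0 ->.
exact: mem0v.
Qed.

Lemma dimHom_zeror M X : is_zero X -> dimHom M X = 0%N.
Proof. by move=> zX; apply/dimHom_eq0 => f _; apply/lfunP => m; rewrite (zX (f m)) zero_lfunE. Qed.

Lemma mono_comp_inj X Y Z (i : 'Hom(Y, Z)) (f g : 'Hom(X, Y)) :
  mono i -> (i \o f = i \o g)%VF -> f = g.
Proof.
move=> mi E; apply/lfunP => x; apply: ((lker0_inj i).1 mi).
by rewrite -!comp_lfunE E.
Qed.

Lemma epi_comp_inj X Y Z (p : 'Hom(X, Y)) (f g : 'Hom(Y, Z)) :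
  epi p -> (f \o p = g \o p)%VF -> f = g.
Proof.
move=> ep E; apply/lfunP => y; have [x ->] := (limg_fullP p).1 ep y.
by rewrite -!comp_lfunE E.
Qed.

Lemma limg_sub_ker X Y Z (f : 'Hom(X, Y)) (g : 'Hom(Y, Z)) :
  (g \o f = 0)%VF -> (limg f <= lker g)%VS.
Proof.
move=> gf; apply/subvP => _ /memv_imgP[x _ ->].
by rewrite memv_ker -comp_lfunE gf zero_lfunE.
Qed.

Lemma limg_sub_kerP X Y Z (f : 'Hom(X, Y)) (g : 'Hom(Y, Z)) :
  (limg f <= lker g)%VS -> (g \o f = 0)%VF.
Proof.
move=> fg; apply/lfunP => x; rewrite comp_lfunE zero_lfunE; apply/eqP.
by rewrite -memv_ker (subvP fg) ?memv_limg.
Qed.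

Lemma dimHom_postcomp M X Y (i : 'Hom(Y, X)) : is_hom i -> mono i ->
  \dim (postcomp M i @: homv M Y) = dimHom M Y.
Proof.
move=> hi mi; apply: limg_dim_eq; apply/eqP; rewrite -subv0; apply/subvP => f.
rewrite memv_cap memv_ker postcompE memv0 => /andP[_ /eqP E]; apply/eqP.
by apply: (mono_comp_inj mi); rewrite E comp_lfun0r.
Qed.

Lemma postcomp_sub M X Y (i : 'Hom(Y, X)) : is_hom i ->
  (postcomp M i @: homv M Y <= homv M X)%VS.
Proof.
move=> hi; apply/subvP => _ /memv_imgP[f /homvP hf ->]; rewrite postcompE.
by apply/homvP; auto.
Qed.

Lemma dimHom_mono M X Y (i : 'Hom(Y, X)) : is_hom i -> mono i -> (dimHom M Y <= dimHom M X)%N.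
Proof. by move=> hi mi; rewrite -(dimHom_postcomp M hi mi) dimvS ?postcomp_sub. Qed.

Lemma dimHom_mono_eq M X Y (i : 'Hom(Y, X)) : is_hom i -> mono i ->
  dimHom M Y = dimHom M X <-> forall g : 'Hom(M, X), is_hom g -> (limg g <= limg i)%VS.
Proof.
move=> hi mi; have sub := postcomp_sub M hi; rewrite -(dimHom_postcomp M hi mi); split.
  move=> E; have /eqP Ev : (postcomp M i @: homv M Y)%VS == homv M X by rewrite eqEdim sub E /=.
  move=> g /homvP; rewrite -Ev => /memv_imgP[f _ ->]; rewrite postcompE.
  by rewrite limg_comp limgS ?subvf.
move=> img; congr (\dim _); apply/eqP; rewrite eqEsubv sub; apply/subvP => g /homvP hg.
have [f hf <-] := factor_mono hi mi hg (img g hg).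
by rewrite -postcompE memv_img //; apply/homvP.
Qed.

Lemma dimHom_short_exact P X Y Z (f : 'Hom(X, Y)) (g : 'Hom(Y, Z)) :
  projective_mod P -> short_exact f g -> dimHom P Y = (dimHom P X + dimHom P Z)%N.
Proof.
move=> pP [[hf hg] mf fg eg]; rewrite -(dimHom_postcomp P hf mf).
rewrite /dimHom -(limg_ker_dim (postcomp P g) (homv P Y)); congr (_ + _)%N.
  congr (\dim _); apply/vspaceP => h; rewrite memv_cap memv_ker postcompE; apply/andP/memv_imgP.
    move=> [/homvP hh /eqP/limg_sub_ker gh].
    have [|h' hh' <-] := factor_mono hf mf hh; first by rewrite fg.
    by exists h'; rewrite ?postcompE //; apply/homvP.
  move=> [h' /homvP hh' ->]; rewrite postcompE; split; first by apply/homvP; auto.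
  by rewrite comp_lfunA (limg_sub_kerP (f := f)) ?fg // comp_lfun0l.
congr (\dim _); apply/vspaceP => h; apply/memv_imgP/idP => [[h' /homvP hh' ->]|/homvP hh].
  by rewrite postcompE; apply/homvP; auto.
by have [l hl E] := pP _ _ _ _ hg eg hh; exists l; [apply/homvP|rewrite postcompE].
Qed.

(** For a minimal presentation [f] of a module M, this says that Hom(X, tau M) = 0; it is the
    working substitute for that condition. *)
Definition extfree P1 P0 (f : 'Hom(P1, P0)) X : Prop :=
  forall h : 'Hom(P1, X), is_hom h -> exists2 k : 'Hom(P0, X), is_hom k & (k \o f)%VF = h.

Definition presentation P1 P0 M (f : 'Hom(P1, P0)) (g : 'Hom(P0, M)) : Prop :=
  [/\ projective_mod P1 /\ projective_mod P0, is_hom f /\ is_hom g & limg f = lker g /\ epi g].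

(** Rank-nullity for precomposition with [f]: a map from [P0] that kills [limg f] is the same as a
    map from [M]. *)
Lemma dimHom_left_exact P1 P0 M X (f : 'Hom(P1, P0)) (g : 'Hom(P0, M)) :
    is_hom f -> is_hom g -> limg f = lker g -> epi g ->
  dimHom P0 X = (dimHom M X + \dim (precomp X f @: homv P0 X))%N.
Proof.
move=> hf hg fg eg; rewrite /dimHom -(limg_ker_dim (precomp X f) (homv P0 X)).
congr (_ + _)%N; rewrite -(@limg_dim_eq _ _ _ (precomp X g) (homv M X)); last first.
  apply/eqP; rewrite -subv0; apply/subvP => h.
  rewrite memv_cap memv_ker precompE memv0 => /andP[_ /eqP E]; apply/eqP.
  by apply: (epi_comp_inj eg); rewrite E comp_lfun0l.
congr (\dim _); apply/vspaceP => h; rewrite memv_cap memv_ker precompE; apply/andP/memv_imgP.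
  move=> [/homvP hh /eqP/limg_sub_ker fh].
  have [|h' hh' <-] := factor_epi hg eg hh; first by rewrite -fg.
  by exists h'; rewrite ?precompE //; apply/homvP.
move=> [h' /homvP hh' ->]; rewrite precompE; split; first by apply/homvP; auto.
by rewrite -comp_lfunA (limg_sub_kerP (f := f)) ?fg // comp_lfun0r.
Qed.

Lemma precomp_sub X Y Z (f : 'Hom(X, Y)) : is_hom f ->
  (precomp Z f @: homv Y Z <= homv X Z)%VS.
Proof.
move=> hf; apply/subvP => _ /memv_imgP[g /homvP hg ->]; rewrite precompE.
by apply/homvP; auto.
Qed.

(** The difference of the two sides is the dimension of Hom(P1, X) modulo the maps factoring through
    [f]. *)
Lemma presentation_le P1 P0 M X (f : 'Hom(P1, P0)) (g : 'Hom(P0, M)) :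
  presentation f g -> (dimHom P0 X <= dimHom M X + dimHom P1 X)%N.
Proof.
move=> [_ [hf hg] [fg eg]]; rewrite (dimHom_left_exact X hf hg fg eg) leq_add2l.
by rewrite dimvS ?precomp_sub.
Qed.

Lemma presentation_eq P1 P0 M X (f : 'Hom(P1, P0)) (g : 'Hom(P0, M)) :
  presentation f g -> dimHom P0 X = (dimHom M X + dimHom P1 X)%N <-> extfree f X.
Proof.
move=> [_ [hf hg] [fg eg]]; rewrite (dimHom_left_exact X hf hg fg eg).
have sub := precomp_sub X hf; split.
  move/addnI => E h; have /eqP Ev : (precomp X f @: homv P0 X)%VS == homv P1 X.
    by rewrite eqEdim sub E /=.
  by move=> /homvP; rewrite -Ev => /memv_imgP[k /homvP hk ->]; exists k; rewrite ?precompE.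
move=> ext; congr (_ + \dim _)%N; apply/eqP; rewrite eqEsubv sub; apply/subvP => h /homvP/ext.
by move=> [k hk <-]; rewrite -precompE memv_img //; apply/homvP.
Qed.

Lemma dimHom_dsum P Q X : dimHom (dsum P Q) X = (dimHom P X + dimHom Q X)%N.
Proof.
have [[hl hr] ml E er] := short_exact_dsum P Q.
rewrite (dimHom_left_exact X hl hr E er) addnC; congr (\dim _ + _)%N.
apply/eqP; rewrite eqEsubv precomp_sub //=; apply/subvP => h /homvP hh.
rewrite -(copair_inl h (0 : 'Hom(Q, X))) -precompE memv_img //.
by apply/homvP; auto.
Qed.

Lemma is_submod_preim X Y (f : 'Hom(X, Y)) (W : {vspace Y}) :
  is_hom f -> is_submod W -> is_submod (f @^-1: W)%VS.
Proof. by move=> hf sW x a; rewrite -!memv_preim hf; apply: sW. Qed.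

Lemma short_exact_quotient X (W : {vspace X}) : is_submod W ->
  exists Y Z (f : 'Hom(Y, X)) (g : 'Hom(X, Z)), short_exact f g /\ limg f = W.
Proof.
move=> sW; have [Y [i [hi mi iY]]] := submodule_exists sW.
have [Z [p [hp ep kp]]] := quotient_exists sW.
by exists Y, Z, i, p; do !split; rewrite // iY.
Qed.

(** Divide by a proper submodule of largest dimension. *)
Lemma exists_simple_quotient X : ~ is_zero X ->
  exists Y Z (f : 'Hom(Y, X)) (g : 'Hom(X, Z)), short_exact f g /\ simple_mod Z.
Proof.
move=> nzX; have [|W [sW nW] Wmax] := @ex_dim_max _ X (fun W => is_submod W /\ W <> fullv).
  exists 0%VS; split; first exact: is_submod0.
  by move=> E; apply: nzX => x; apply/eqP; rewrite -memv0 E memvf.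
have [Y [Z [f [g [fg E]]]]] := short_exact_quotient sW.
exists Y, Z, f, g; split=> //; have [[hf hg] mf fgE eg] := fg; split.
  move=> zZ; apply: nW; rewrite -E fgE; apply/vspaceP => x.
  by rewrite memvf memv_ker (zZ (g x)) eqxx.
move=> V sV; have sV' := is_submod_preim hg sV.
have WV : (W <= g @^-1: V)%VS by rewrite -E fgE -lpreim0 lpreimS ?sub0v.
have [Vf|nVf] := eqVneq (g @^-1: V)%VS fullv; [right|left].
  apply/vspaceP => z; have [x ->] := (limg_fullP g).1 eg z.
  by rewrite memv_preim Vf !memvf.
have le := Wmax _ (conj sV' (elimN eqP nVf)).
have /eqP WE : W == (g @^-1: V)%VS by rewrite eqEdim WV.
apply/vspaceP => z; have [x ->] := (limg_fullP g).1 eg z.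
by rewrite memv_preim -WE -E fgE memv_ker memv0.
Qed.

Lemma lker_mono_comp X Y Z (g : 'Hom(X, Y)) (h : 'Hom(Y, Z)) :
  mono h -> lker (h \o g)%VF = lker g.
Proof. by move=> mh; apply/vspaceP => x; rewrite !memv_ker comp_lfunE mono_eq0. Qed.

Lemma dim_short_exact X Y Z (f : 'Hom(X, Y)) (g : 'Hom(Y, Z)) :
  short_exact f g -> (\dim {:X} + \dim {:Z})%N = \dim {:Y}.
Proof.
move=> [[hf hg] mf fg eg]; rewrite -(limg_ker_dim g fullv) capfv eg -fg.
by rewrite limg_dim_eq // mf capv0.
Qed.

(** * Composition factors and dimension vectors *)

Section CompositionFactors.
Variables (n : nat) (S : 'I_n -> rmod A).
Hypothesis S_simples : simple_reps S.

Lemma comp_series_exists X : exists s, comp_series S X s.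
Proof.
have [m] := ubnP (\dim {:X}); elim: m X => // m IH X ltm.
have [zX|nzX] := pselect (is_zero X); first by exists [::]; constructor.
have [Y [Z [f [g [fg sZ]]]]] := exists_simple_quotient nzX.
have [_ _ /(_ _ sZ)[i [h [hh mh eh]]]] := S_simples.
have [|s Ys] := IH Y.
  rewrite -ltnS; apply: leq_ltn_trans ltm; rewrite -(dim_short_exact fg) -addn1 leq_add2l lt0n.
  by apply/eqP => /is_zeroP; case: sZ.
have [[hf hg] mf fgE eg] := fg.
exists (i :: s); apply: (@comp_series_cons _ _ _ _ X Y i s f (h \o g)%VF) Ys.
split; auto; first by rewrite lker_mono_comp.
exact: comp_lfun_epi.
Qed.

Lemma dimHom_comp_series P X s : projective_mod P -> comp_series S X s ->
  dimHom P X = (\sum_(i <- s) dimHom P (S i))%N.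
Proof.
move=> pP; elim=> [{}X zX|{}X Y i {}s f g fg _ IH]; first by rewrite big_nil dimHom_zeror.
by rewrite big_cons (dimHom_short_exact pP fg) IH addnC.
Qed.

Lemma comp_factorsP X : comp_series S X (comp_factors S X).
Proof. exact: (xgetPex [::] (comp_series_exists X)). Qed.

Lemma dimvec_zero X : (forall i, dimvec S X 0 i = 0%N) -> is_zero X.
Proof.
move=> d0; have := comp_factorsP X; case E: (comp_factors S X) => [|i s] c.
  by inversion c.
by have := d0 i; rewrite mxE E /= eqxx.
Qed.

(** Exactness of Hom(P, -) makes [dimHom P] additive along the chosen composition series. This is
    the source of all the functionals used later. *)
Lemma dimHom_dimvec P X : projective_mod P ->
  dimHom P X = (\sum_(i < n) dimHom P (S i) * dimvec S X 0%R i)%N.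
Proof.
move=> pP; rewrite (dimHom_comp_series pP (comp_factorsP X)).
under [RHS]eq_bigr do rewrite mxE.
elim: (comp_factors S X) => [|j s IH]; first by rewrite big_nil big1 // => i _; rewrite muln0.
rewrite big_cons IH [in RHS](eq_bigr (fun i => dimHom P (S i) * (j == i) +
  dimHom P (S i) * count_mem i s)%N).
  rewrite big_split /=; congr (_ + _)%N; rewrite (bigD1 j) //= eqxx muln1 big1 ?addn0 //.
  by move=> i; rewrite eq_sym => /negPf ->; rewrite muln0.
by move=> i _; rewrite -mulnDr.
Qed.

End CompositionFactors.

(** * Presentations and left approximations *)

Lemma projective_lift Q P1 P0 (f : 'Hom(P1, P0)) (h : 'Hom(Q, P0)) :
    projective_mod Q -> is_hom f -> is_hom h -> (limg h <= limg f)%VS ->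
  exists2 l : 'Hom(Q, P1), is_hom l & (f \o l)%VF = h.
Proof.
move=> pQ hf hh le; have [Y [i [hi mi iY]]] := submodule_exists (is_submod_limg hf).
have [|f' hf' if'] := factor_mono hi mi hf; first by rewrite iY.
have [|h' hh' ih'] := factor_mono hi mi hh; first by rewrite iY.
have ef' : epi f'.
  apply/limg_fullP => y; have : i y \in limg f by rewrite -iY memv_limg.
  case/memv_imgP=> x _; rewrite -if' comp_lfunE => /((lker0_inj i).1 mi) ->.
  by exists x.
have [l hl E] := pQ _ _ _ _ hf' ef' hh'.
by exists l => //; rewrite -if' -comp_lfunA -E ih'.
Qed.

(** The image of [\1 + t] together with [lker f] spans everything, so [\1 + t] is surjective and
    hence invertible. It serves to correct identities that hold only up to [lker f]. *)
Lemma superfluous_unit Q1 Q0 (f : 'Hom(Q1, Q0)) (t : 'End(Q1)) :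
    is_hom f -> superfluous (lker f) -> is_hom t -> (f \o t = 0)%VF ->
  exists u : 'End(Q1), [/\ is_hom u, ((\1 + t) \o u = \1)%VF & (f \o u)%VF = f].
Proof.
move=> hf sf ht ft; have h1 : is_hom (\1 + t)%VF by auto.
have e1 : epi (\1 + t)%VF.
  apply: sf; auto; apply/eqP; rewrite eqEsubv subvf /=; apply/subvP => x _.
  rewrite -[x](subrK ((\1 + t)%VF x)) addrC memv_add ?memv_limg //.
  rewrite !lfun_simp opprD addNKr memv_ker linearN /= -comp_lfunE ft zero_lfunE.
  by rewrite oppr0.
have [u [hu _ E]] := hom_inverse h1 (epi_dim_mono e1 (leqnn _)) e1.
exists u; split=> //.
have f1 : (f \o (\1 + t))%VF = f by rewrite comp_lfunDr ft addr0 comp_lfun1r.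
by rewrite -[in LHS]f1 -comp_lfunA E comp_lfun1r.
Qed.

(* A lift of the inclusion and the retraction to the presentations differs
   from the identity by a homotopy [s] and a map [t] into [lker f']; the latter
   is harmless because [lker f'] is superfluous. *)
Lemma extfree_retract N M X P1 P0 (f : 'Hom(P1, P0)) (g : 'Hom(P0, M))
    Q1 Q0 (f' : 'Hom(Q1, Q0)) (g' : 'Hom(Q0, N)) :
    retract N M -> presentation f g -> presentation f' g' -> superfluous (lker f') ->
  extfree f X -> extfree f' X.
Proof.
move=> [i [r [hi hr ri]]] [[pP1 pP0] [hf hg] [fg eg]] [[pQ1 pQ0] [hf' hg'] [fg' eg']] sf' ext h hh.
have gf0 : (g \o f = 0)%VF by apply: limg_sub_kerP; rewrite fg.
have gf0' : (g' \o f' = 0)%VF by apply: limg_sub_kerP; rewrite fg'.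
have [||a0 ha0 ga0] := @projective_lift Q0 P0 M g (i \o g')%VF pQ0 hg; auto.
  by rewrite eg subvf.
have [||b0 hb0 gb0] := @projective_lift P0 Q0 N g' (r \o g)%VF pP0 hg'; auto.
  by rewrite eg' subvf.
have [||a1 ha1 fa1] := @projective_lift Q1 P1 P0 f (a0 \o f')%VF pQ1 hf; auto.
  by rewrite fg; apply: limg_sub_ker; rewrite comp_lfunA ga0 -comp_lfunA gf0' comp_lfun0r.
have [||b1 hb1 fb1] := @projective_lift P1 Q1 Q0 f' (b0 \o f)%VF pP1 hf'; auto.
  by rewrite fg'; apply: limg_sub_ker; rewrite comp_lfunA gb0 -comp_lfunA gf0 comp_lfun0r.
have [||s hs fs] := @projective_lift Q0 Q1 Q0 f' ((b0 \o a0) - \1)%VF pQ0 hf'; auto.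
  rewrite fg'; apply: limg_sub_ker.
  rewrite comp_lfunDr comp_lfunNr comp_lfun1r comp_lfunA gb0 -comp_lfunA ga0 comp_lfunA ri.
  by rewrite comp_lfun1l subrr.
pose t := ((b1 \o a1) - \1 - (s \o f'))%VF.
have ft : (f' \o t = 0)%VF.
  rewrite /t !(comp_lfunDr, comp_lfunNr) !comp_lfunA fb1 fs -comp_lfunA fa1 comp_lfun1r.
  by rewrite comp_lfunDl comp_lfunNl comp_lfun1l !comp_lfunA subrr.
have [|u [hu tu fu]] := superfluous_unit hf' sf' _ ft; first by rewrite /t; auto.
have [k hk kf] := ext (h \o b1)%VF (is_hom_comp hh hb1).
(* Composed with [f'], this witness gives [h \o (\1 + t)]; composing with [u], which [f'] absorbs,
   removes [t]. *)
exists ((k \o a0) - (h \o s))%VF; first by auto.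
rewrite -[in LHS]fu comp_lfunA -[RHS]comp_lfun1r -tu comp_lfunA; congr (_ \o _)%VF.
have -> : (\1 + t)%VF = ((b1 \o a1) - (s \o f'))%VF.
  by rewrite /t addrA [in X in X - _]addrC subrK.
rewrite !(comp_lfunDl, comp_lfunDr, comp_lfunNl, comp_lfunNr) !comp_lfunA -kf.
by congr (_ - _); rewrite -!comp_lfunA fa1.
Qed.

Lemma minimal_presentation_exists M :
  exists P1 P0 (f : 'Hom(P1, P0)) (g : 'Hom(P0, M)), minimal_projective_presentation f g.
Proof.
have [P0 [g [pP0 hg eg sg]]] := projective_cover_exists M.
have [Y [i [hi mi iY]]] := submodule_exists (is_submod_lker hg).
have [P1 [p [pP1 hp ep sp]]] := projective_cover_exists Y.
exists P1, P0, (i \o p)%VF, g; split; auto.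
  by split; rewrite // limg_comp ep.
by rewrite lker_mono_comp.
Qed.

Lemma minimal_presentation P1 P0 M (f : 'Hom(P1, P0)) (g : 'Hom(P0, M)) :
  minimal_projective_presentation f g -> presentation f g.
Proof. by case. Qed.

Lemma extfree_dsum P1 P0 (f : 'Hom(P1, P0)) X Y :
  extfree f X -> extfree f Y -> extfree f (dsum X Y).
Proof.
move=> eX eY h hh.
have [k hk E] := eX _ (is_hom_comp (@is_hom_dfst X Y) hh).
have [k' hk' E'] := eY _ (is_hom_comp (@is_hom_dsnd X Y) hh).
exists ((dinl X Y \o k) + (dinr X Y \o k'))%VF; auto.
by rewrite comp_lfunDl -!comp_lfunA E E' !comp_lfunA -comp_lfunDl dsum_id comp_lfun1l.
Qed.

Lemma extfree_quotient P1 P0 (f : 'Hom(P1, P0)) X Y :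
  projective_mod P1 -> quotient_of X Y -> extfree f X -> extfree f Y.
Proof.
move=> pP1 [p [hp ep]] eX h hh; have [l hl ->] := pP1 _ _ _ _ hp ep hh.
have [k hk <-] := eX l hl; exists (p \o k)%VF; auto.
by rewrite comp_lfunA.
Qed.

Lemma extfree_zero P1 P0 (f : 'Hom(P1, P0)) X : is_zero X -> extfree f X.
Proof.
move=> zX h _; exists 0; first exact: is_hom0.
by apply/lfunP => x; rewrite (zX (h x)); apply: zX.
Qed.

Lemma extfree_gen P1 P0 (f : 'Hom(P1, P0)) M X :
  projective_mod P1 -> extfree f M -> gen M X -> extfree f X.
Proof.
move=> pP1 eM /genP[k]; move/(extfree_quotient pP1); apply.
elim: k => [|k IH] /=; first exact/extfree_zero/zero_mod_zero.
exact: extfree_dsum.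
Qed.

Lemma gen_torsion P1 P0 M (f : 'Hom(P1, P0)) (g : 'Hom(P0, M)) :
  presentation f g -> extfree f M -> torsion_class (gen M).
Proof.
move=> [[pP1 pP0] [hf hg] [fg eg]] eM; split=> [X Y|X Y Z a b ab gX gZ].
  exact: gen_quotient.
apply: (gen_extension ab) => // h hh; have [[ha hb] ma abE eb] := ab.
have gf0 : (g \o f = 0)%VF by apply: limg_sub_kerP; rewrite fg.
have [l hl bl] := pP0 _ _ _ _ hb eb (is_hom_comp hh hg).
have [||m hm am] := @factor_mono _ _ _ a (l \o f)%VF ha ma; auto.
  by rewrite abE; apply: limg_sub_ker; rewrite comp_lfunA -bl -comp_lfunA gf0 comp_lfun0r.
have [k hk kf] := extfree_gen pP1 eM gX hm.
have [||h' hh' h'g] := @factor_epi _ _ _ g (l - (a \o k))%VF hg eg; auto.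
  rewrite -fg; apply: limg_sub_ker.
  by rewrite comp_lfunDl comp_lfunNl -comp_lfunA kf am subrr.
exists h' => //; apply: (epi_comp_inj eg); rewrite -comp_lfunA h'g comp_lfunDr -bl comp_lfunNr.
by rewrite comp_lfunA (limg_sub_kerP (f := a)) ?abE // comp_lfun0l subr0.
Qed.

(** * Left approximations of the regular module *)

Section LeftApproximation.
Variable N : rmod A.

Definition left_approximation T (phi : 'Hom(regmod A, T)) : Prop :=
  [/\ is_hom phi, gen N T & forall X (h : 'Hom(regmod A, X)), is_hom h -> gen N X ->
    exists2 k : 'Hom(T, X), is_hom k & (k \o phi)%VF = h].

(** A map from the regular module is an element [t] of [T]. Choose [(T, t)] so that the values at
    [t] of maps [T -> N] fill a subspace of [N] of largest dimension. Adjoining a summand [N] with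
    an element [y] reaches [y] as well, so all of [N] is already reached, and then every module
    generated by [N]. *)
Lemma left_approximation_exists : exists T (phi : 'Hom(regmod A, T)), left_approximation phi.
Proof.
pose reach T (t : T) X (x : X) := exists2 k : 'Hom(T, X), is_hom k & k t = x.
have reach_lin T (t : T) X : exists E : {vspace X}, forall x, x \in E <-> reach T t X x.
  apply: vspace_of_pred; first by exists 0; [exact: is_hom0|rewrite zero_lfunE].
  move=> c u v [k hk <-] [k' hk' <-]; exists (c *: k + k')%VF; first exact: is_homP.
  by rewrite add_lfunE scale_lfunE.
have [|W [T [t [gT tW]]] Wmax] := @ex_dim_max _ N (fun W => exists T (t : T), gen N T /\
    forall y, y \in W <-> reach T t N y).
  have [E hE] := reach_lin (zero_mod A) 0 N.
  by exists E, (zero_mod A), 0; split=> //; apply/gen_zero/zero_mod_zero.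
have Nt y : reach T t N y.
  have [E hE] := reach_lin (dsum N T) (y, t) N.
  have /Wmax le : exists T (t : T), gen N T /\ forall y, y \in E <-> reach T t N y.
    by exists (dsum N T), (y, t); split=> //; apply: gen_dsum => //; apply: gen_refl.
  have WE : (W <= E)%VS.
    apply/subvP => z /tW[k hk <-]; apply/hE; exists (k \o dsnd N T)%VF; auto.
    by rewrite comp_lfunE dsndE.
  apply/tW; have /eqP -> : W == E by rewrite eqEdim WE.
  by apply/hE; exists (dfst N T) => //; rewrite dfstE.
exists T, (orbit_map t); split=> // X h hh gX.
have [E hE] := reach_lin T t X.
have Ef : E = fullv.
  apply: gX => g hg; apply/subvP => _ /memv_imgP[y _ ->]; apply/hE.
  by have [k hk <-] := Nt y; exists (g \o k)%VF; auto; rewrite comp_lfunE.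
have /hE[k hk kt] : h 1 \in E by rewrite Ef memvf.
exists k => //; apply/lfunP => a; rewrite comp_lfunE orbit_mapE hk kt -hh.
by congr (h _); rewrite /= /reg_act mul1r.
Qed.

(* A lift of [phi] through [p] extends to [T], and the resulting endomorphism of
   [T] fixes [phi]; it is bijective because [T] has minimal dimension. *)
Lemma minimal_left_approximation : exists T (phi : 'Hom(regmod A, T)),
  left_approximation phi /\
  forall Y (p : 'Hom(Y, T)), is_hom p -> epi p -> gen N Y ->
    exists2 s : 'Hom(T, Y), is_hom s & (p \o s)%VF = \1%VF.
Proof.
pose Q d := `[< exists T (phi : 'Hom(regmod A, T)), left_approximation phi /\ \dim {:T} = d >].
have exQ : exists d, Q d.
  have [T [phi aT]] := left_approximation_exists.
  by exists (\dim {:T}); apply/asboolP; exists T, phi.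
case: (ex_minnP exQ) => d /asboolP[T [phi [aT dT]]] dmin.
exists T, phi; split=> // Y p hp ep gY; have [hphi gT aphi] := aT.
have [l hl pl] := @projective_regmod _ _ p phi hp ep hphi.
have [k hk kl] := aphi _ _ hl gY.
pose e := (p \o k)%VF; have he : is_hom e by apply: is_hom_comp.
have ephi : (e \o phi)%VF = phi by rewrite -comp_lfunA kl.
have [Z [i [hi mi iZ]]] := submodule_exists (is_submod_limg he).
have [|c hc ic] := factor_mono hi mi he; first by rewrite iZ.
have [|phi' hphi' iphi'] := factor_mono hi mi hphi.
  by rewrite iZ -ephi limg_comp limgS ?subvf.
have aZ : left_approximation phi'.
  split=> //.
    apply: gen_quotient gT _; exists c; split=> //; apply/limg_fullP => z.
    have : i z \in limg e by rewrite -iZ memv_limg.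
    by case/memv_imgP=> x _; rewrite -ic comp_lfunE => /((lker0_inj i).1 mi) ->; exists x.
  move=> X h hh gX; have [m hm <-] := aphi X h hh gX.
  by exists (m \o i)%VF; auto; rewrite -comp_lfunA iphi'.
have le : (d <= \dim {:Z})%N by apply: dmin; apply/asboolP; exists Z, phi'.
have ee : epi e.
  apply/eqP; rewrite eqEdim subvf /= dT; apply: leq_trans le _.
  by rewrite -iZ limg_dim_eq // mi capv0.
have [u [hu _ eu]] := hom_inverse he (epi_dim_mono ee (leqnn _)) ee.
by exists (k \o u)%VF; auto; rewrite comp_lfunA.
Qed.

(* Split projective objects of a torsion class are Ext-projective: a map
   [h : P1 -> X] gives an extension of [T] by the image of [X] in the cokernel of
   [(h, - f) : P1 -> X + P0], and a splitting of it extends [h] to [P0] up to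
   [lker f]. *)
Lemma split_projective_extfree T P1 P0 (f : 'Hom(P1, P0)) (g : 'Hom(P0, T)) X :
    torsion_class (gen N) -> gen N T ->
    (forall Y (p : 'Hom(Y, T)), is_hom p -> epi p -> gen N Y ->
      exists2 s : 'Hom(T, Y), is_hom s & (p \o s)%VF = \1%VF) ->
    presentation f g -> superfluous (lker f) -> gen N X ->
  extfree f X.
Proof.
move=> [_ tN] gT splT [[pP1 pP0] [hf hg] [fg eg]] sf gX h hh.
have gf0 : (g \o f = 0)%VF by apply: limg_sub_kerP; rewrite fg.
pose c := ((dinl X P0 \o h) - (dinr X P0 \o f))%VF; have hc : is_hom c by rewrite /c; auto.
have cE z : c z = (h z, - f z).
  rewrite /c add_lfunE opp_lfunE !comp_lfunE dinlE dinrE; apply/pair_equal_spec; split; rewrite /=.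
    by rewrite subr0.
  by rewrite sub0r.
have [Y [q [hq eq kq]]] := quotient_exists (is_submod_limg hc).
pose i := (q \o dinl X P0)%VF; pose j := (q \o dinr X P0)%VF.
have hi : is_hom i by rewrite /i; auto.
have hj : is_hom j by rewrite /j; auto.
have qE x y : q (x, y) = i x + j y.
  rewrite !comp_lfunE -linearD dinlE dinrE /=; congr (q _).
  by apply/pair_equal_spec; rewrite /= addr0 add0r.
have ijf : (i \o h = j \o f)%VF.
  apply/lfunP => z; rewrite !(comp_lfunE _ _ z); apply/eqP; rewrite -subr_eq0 -linearN -qE -cE.
  by rewrite -memv_ker kq memv_limg.
pose g0 := copair (0 : 'Hom(X, T)) g.
have g0c : (g0 \o c = 0)%VF.
  apply/lfunP => z; rewrite comp_lfunE cE copairE !zero_lfunE add0r linearN /= -comp_lfunE gf0.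
  by rewrite zero_lfunE oppr0.
have [||pi hpi piq] := @factor_epi _ _ _ q g0 hq eq; rewrite /g0; auto.
  by rewrite kq; apply: limg_sub_ker.
have pij : (pi \o j)%VF = g by rewrite comp_lfunA piq copair_inr.
have pii : (pi \o i)%VF = 0 by rewrite comp_lfunA piq copair_inl.
have epi_pi : epi pi.
  apply/limg_fullP => t; have [y ->] := (limg_fullP g).1 eg t.
  by exists (j y); rewrite -comp_lfunE pij.
have kpi : limg i = lker pi.
  apply/eqP; rewrite eqEsubv (limg_sub_ker pii) /=; apply/subvP => y.
  have [[x z] ->] := (limg_fullP q).1 eq y; rewrite qE memv_ker linearD /=.
  rewrite -!comp_lfunE pii pij zero_lfunE add0r -memv_ker -fg => /memv_imgP[w _ ->].
  by rewrite -comp_lfunE -ijf comp_lfunE -linearD memv_limg.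
have [I [m [hm mm mI]]] := submodule_exists (is_submod_limg hi).
have gI : gen N I.
  have [|i' hi' mi'] := factor_mono hm mm hi; first by rewrite mI.
  apply: gen_quotient gX _; exists i'; split=> //; apply/limg_fullP => y.
  have : m y \in limg i by rewrite -mI memv_limg.
  by case/memv_imgP=> x _; rewrite -mi' comp_lfunE => /((lker0_inj m).1 mm) ->; exists x.
have gY : gen N Y by apply: (tN I Y T m pi) => //; do !split; rewrite ?mI.
have [s hs pis] := splT _ _ hpi epi_pi gY.
have [||k hk ik] := @projective_lift P0 X Y i (j - (s \o g))%VF pP0 hi; auto.
  rewrite kpi; apply: limg_sub_ker.
  by rewrite comp_lfunDr comp_lfunNr pij comp_lfunA pis comp_lfun1l subrr.
have ihk : (i \o (h - (k \o f)) = 0)%VF.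
  rewrite comp_lfunDr comp_lfunNr comp_lfunA ik comp_lfunDl comp_lfunNl -comp_lfunA gf0.
  by rewrite comp_lfun0r subr0 ijf subrr.
have [R [v [hv mv vR]]] := submodule_exists (is_submod_lker hf).
(* The kernel of [i] consists of the values of [h] on [lker f], so [h - k \o f] factors as
   [h \o v \o l]. Then [k \o f = h \o (\1 - v \o l)], and [f] kills [v \o l]. *)
have [|||l hl hvl] := @projective_lift P1 R X (h \o v)%VF (h - (k \o f))%VF pP1; auto.
  apply/subvP => x /(subvP (limg_sub_ker ihk)); rewrite memv_ker => /eqP ix0.
  have : (x, 0) \in limg c by rewrite -kq memv_ker qE ix0 linear0 addr0.
  case/memv_imgP=> z _; rewrite cE => -[-> /esym/eqP]; rewrite oppr_eq0 -memv_ker -vR.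
  by case/memv_imgP=> w _ ->; rewrite -comp_lfunE memv_limg.
have [||u [hu tu fu]] := @superfluous_unit _ _ f (- (v \o l))%VF hf sf; auto.
  by rewrite comp_lfunNr comp_lfunA (limg_sub_kerP (f := v)) ?vR // comp_lfun0l oppr0.
exists k => //; rewrite -fu comp_lfunA -[RHS]comp_lfun1r -tu comp_lfunA; congr (_ \o _)%VF.
rewrite comp_lfunDr comp_lfunNr comp_lfun1r comp_lfunA hvl opprD addrA subrr sub0r.
by rewrite opprK.
Qed.

End LeftApproximation.

(** * The Auslander-Reiten translation *)

Lemma orbit_map_hom X Y (h : 'Hom(X, Y)) x : is_hom h ->
  (h \o orbit_map x)%VF = orbit_map (h x).
Proof. by move=> hh; apply/lfunP => a; rewrite comp_lfunE !orbit_mapE hh. Qed.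

Lemma orbit_mapP X k (x y : X) : orbit_map (k *: x + y) = k *: orbit_map x + orbit_map y.
Proof.
by apply/lfunP => a; rewrite add_lfunE scale_lfunE !orbit_mapE ractDl ractZl.
Qed.

Lemma orbit_map_reg (a : A) : orbit_map (a : regmod A) = (amull a : 'End(regmod A)).
Proof. by apply/lfunP => b; rewrite orbit_mapE. Qed.

Lemma orbit_map_ract X P (x : X) a (h : 'Hom(P, regmod A)) :
  (orbit_map (ract x a) \o h = orbit_map x \o hom_reg_lact a h)%VF.
Proof.
rewrite /hom_reg_lact -orbit_map_reg comp_lfunA orbit_map_hom //.
by rewrite orbit_mapE.
Qed.

Lemma is_hom_reg_lact P a (h : 'Hom(P, regmod A)) : is_hom h -> is_hom (hom_reg_lact a h).
Proof. by move=> hh; rewrite /hom_reg_lact -orbit_map_reg; auto. Qed.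

Lemma hom_reg_lact_comp P Q a (h : 'Hom(P, regmod A)) (f : 'Hom(Q, P)) :
  (hom_reg_lact a h \o f)%VF = hom_reg_lact a (h \o f)%VF.
Proof. by rewrite /hom_reg_lact comp_lfunA. Qed.

Fact hom_reg_lact_linearr P a : linear (@hom_reg_lact K A P a).
Proof. by move=> k h h'; rewrite /hom_reg_lact comp_lfunDr comp_lfunZr. Qed.

Fact hom_reg_lact_linearl P (h : 'Hom(P, regmod A)) : linear (@hom_reg_lact K A P ^~ h).
Proof. by move=> k a b; rewrite /hom_reg_lact -!orbit_map_reg orbit_mapP comp_lfunDl comp_lfunZl. Qed.

Lemma hom_reg_lact1 P (h : 'Hom(P, regmod A)) : hom_reg_lact 1 h = h.
Proof. by rewrite /hom_reg_lact amull1 comp_lfun1l. Qed.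

Lemma hom_reg_lactM P a b (h : 'Hom(P, regmod A)) :
  hom_reg_lact (a * b) h = hom_reg_lact a (hom_reg_lact b h).
Proof.
rewrite /hom_reg_lact comp_lfunA; congr (_ \o _)%VF.
by rewrite -!orbit_map_reg orbit_map_hom // orbit_mapE.
Qed.

(* The dual basis lemma, with [x (x) kappa] written as [orbit_map x \o kappa]. *)
Lemma dual_basis P : projective_mod P ->
  exists r : seq (P * 'Hom(P, regmod A)),
    (forall u, u \in r -> is_hom u.2) /\
    (\1 = \sum_(u <- r) (orbit_map u.1 \o u.2))%VF.
Proof.
move=> pP; have [k [q [hq eq]]] := (genP (regmod A) P).1 (@gen_regmod P).
have [s hs qs] := split_epi_projective pP hq eq.
suff [r hr qsE] : exists2 r : seq (P * 'Hom(P, regmod A)),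
    (forall u, u \in r -> is_hom u.2) & (q \o s = \sum_(u <- r) (orbit_map u.1 \o u.2))%VF.
  by exists r; rewrite -qsE qs.
elim: k q s hq hs {eq qs} => [|k IH] q s hq hs.
  exists [::] => //; rewrite big_nil; apply/lfunP => x; rewrite comp_lfunE zero_lfunE.
  by rewrite (@zero_mod_zero (s x)) linear0.
pose D := dsums (nseq k (regmod A)); change (dsums _) with (dsum (regmod A) D) in q, s.
have [||r hr E] := IH (q \o dinr _ D)%VF (dsnd _ D \o s)%VF; [by auto|by auto|].
exists ((q (dinl (regmod A) D (1 : A)), (dfst _ D \o s)%VF) :: r).
  by move=> u; rewrite inE => /predU1P[->|/hr //]; apply: is_hom_comp hs; apply: is_hom_dfst.
have -> : (q \o s = ((q \o dinl _ D) \o (dfst _ D \o s)) + ((q \o dinr _ D) \o (dsnd _ D \o s)))%VF.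
  by rewrite -[in LHS](comp_lfun1l s) -dsum_id comp_lfunDl comp_lfunDr !comp_lfunA.
have qI : (q \o dinl _ D = orbit_map (q (dinl (regmod A) D (1 : A))))%VF.
  rewrite -(orbit_map_hom _ hq) -(orbit_map_hom _ (@is_hom_dinl _ _)) orbit_map_reg amull1.
  by rewrite comp_lfun1r.
by rewrite big_cons -E qI.
Qed.

Section Transpose.
Variables (P1 P0 : rmod A) (f : 'Hom(P1, P0)) (L : lmod A).
Variable pi : 'Hom('Hom(P1, regmod A), L).
Hypotheses (pP1 : projective_mod P1) (pP0 : projective_mod P0) (hf : is_hom f).
Hypothesis pi_surj : forall l, exists2 h, is_hom h & pi h = l.
Hypothesis pi_lact : forall a h, is_hom h -> pi (hom_reg_lact a h) = lact a (pi h).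
Hypothesis pi_ker : forall h, is_hom h ->
  (pi h = 0 <-> exists2 k : 'Hom(P0, regmod A), is_hom k & h = (k \o f)%VF).

(* A homomorphism [theta : X -> D L] amounts to the functional
   [x (x) h |-> theta x (pi h)] on [X (x) Hom(P1, A) = Hom(P1, X)], which kills
   the maps factoring through [f]. *)
Lemma extfree_transpose X : extfree f X -> hom_zero X (dual_mod L).
Proof.
move=> ext theta htheta; have [r1 [hr1 E1]] := dual_basis pP1.
have [r0 [hr0 E0]] := dual_basis pP0.
pose Theta (h : 'Hom(P1, X)) : K := \sum_(u <- r1) (theta (h u.1) : 'Hom(L, K^o)) (pi u.2).
have ThetaE x (h0 : 'Hom(P1, regmod A)) : is_hom h0 ->
    Theta (orbit_map x \o h0)%VF = (theta x : 'Hom(L, K^o)) (pi h0).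
  move=> hh0; have {2}-> : h0 = \sum_(u <- r1) hom_reg_lact (h0 u.1) u.2.
    rewrite -[LHS]comp_lfun1r E1 comp_lfun_sumr; apply: eq_bigr => u _.
    by rewrite comp_lfunA orbit_map_hom // orbit_map_reg.
  rewrite !linear_sum /Theta; apply: eq_big_seq => u ur1 /=.
  by rewrite comp_lfunE orbit_mapE htheta /= dual_actE pi_lact //; apply: hr1.
apply/lfunP => x; apply/lfunP => l; rewrite !zero_lfunE.
have [h0 hh0 <-] := pi_surj l; rewrite -ThetaE //.
have [k hk kf] := ext _ (is_hom_comp (is_hom_orbit x) hh0).
have -> : (orbit_map x \o h0 = \sum_(v <- r0) (orbit_map (k v.1) \o (v.2 \o f)))%VF.
  rewrite -kf -[in LHS](comp_lfun1r k) E0 comp_lfun_sumr comp_lfun_suml; apply: eq_bigr => v _.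
  by rewrite !comp_lfunA orbit_map_hom.
transitivity (\sum_(v <- r0) Theta (orbit_map (k v.1) \o (v.2 \o f))%VF).
  rewrite /Theta exchange_big; apply: eq_bigr => u _ /=.
  by rewrite sum_lfunE linear_sum sum_lfunE.
rewrite big1_seq // => v /andP[_ vr0]; have hv := hr0 v vr0.
rewrite ThetaE; last by auto.
suff -> : pi (v.2 \o f)%VF = 0 by rewrite linear0.
by apply/(pi_ker (is_hom_comp hv hf)); exists v.2.
Qed.

(** If [h] does not factor through [f], a functional [Lam] kills the maps that do but not [h]. The
    formula [th x l = Lam (orbit_map x \o s l)] defines a homomorphism to the dual of [L], hence
    zero; a dual basis of [P1] then yields [Lam h = 0]. *)
Lemma transpose_extfree X : hom_zero X (dual_mod L) -> extfree f X.
Proof.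
move=> h0 h hh; apply: contrapT => nh; pose F := (precomp X f @: homv P0 X)%VS.
have [|Lam LamF Lamh] := @separating_functional _ _ F h.
  apply/negP => /memv_imgP[k /homvP hk]; rewrite precompE => E.
  by apply: nh; exists k.
have [|s sP] := @linear_section _ _ _ pi (homv P1 (regmod A)).
  apply/vspaceP => l; rewrite memvf; have [h' /homvP hh' <-] := pi_surj l.
  exact: memv_img.
(* This makes the choice of representative [s l] immaterial: two choices differ by a map factoring
   through [f], which [Lam] kills after composition. *)
have Lam0 x (d : 'Hom(P1, regmod A)) : is_hom d -> pi d = 0 -> Lam (orbit_map x \o d)%VF = 0.
  move=> hd /(pi_ker hd)[k hk ->]; apply: LamF; rewrite comp_lfunA -precompE.
  by apply: memv_img; apply/homvP; auto.
have hs l : is_hom (s l) by apply/homvP; case: (sP l).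
have pis l : pi (s l) = l by case: (sP l).
have LamE x (d : 'Hom(P1, regmod A)) : is_hom d ->
    Lam (orbit_map x \o d)%VF = Lam (orbit_map x \o s (pi d))%VF.
  move=> hd; apply/eqP; rewrite -subr_eq0 -linearB -comp_lfunNr -comp_lfunDr; apply/eqP.
  by apply: Lam0; [auto|rewrite linearB /= pis subrr].
pose th (x : X) : 'Hom(L, K^o) := (Lam \o (postcomp P1 (orbit_map x) \o s))%VF.
have thE x l : th x l = Lam (orbit_map x \o s l)%VF by rewrite !comp_lfunE postcompE.
have th_lin : linear (th : X -> dual_mod L).
  move=> k x y; apply/lfunP => l; rewrite add_lfunE scale_lfunE !thE.
  by rewrite orbit_mapP comp_lfunDl -comp_lfunZl linearP.
have hth : is_hom (lfun_of th_lin).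
  move=> x a; rewrite !lfun_ofE; apply/lfunP => l; rewrite dual_actE !thE.
  by rewrite orbit_map_ract LamE ?pi_lact ?pis //; apply: is_hom_reg_lact.
have th0 x l : Lam (orbit_map x \o s l)%VF = 0.
  rewrite -thE; have /lfunP/(_ x) := h0 _ hth; rewrite lfun_ofE zero_lfunE => ->.
  exact: zero_lfunE.
have [r [hr E]] := dual_basis pP1.
move/eqP: Lamh; apply; rewrite -[h]comp_lfun1r E comp_lfun_sumr linear_sum big1_seq //= => u ur.
by rewrite comp_lfunA orbit_map_hom // LamE ?th0 //; apply: hr.
Qed.

End Transpose.

Lemma transpose_exists P1 P0 (f : 'Hom(P1, P0)) : is_hom f ->
  exists (L : lmod A) (pi : 'Hom('Hom(P1, regmod A), L)),
    [/\ forall l, exists2 h, is_hom h & pi h = l,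
        forall a h, is_hom h -> pi (hom_reg_lact a h) = lact a (pi h) &
        forall h, is_hom h ->
          (pi h = 0 <-> exists2 k : 'Hom(P0, regmod A), is_hom k & h = (k \o f)%VF)].
Proof.
move=> hf; pose H := homv P1 (regmod A).
pose F := (precomp (regmod A) f @: homv P0 (regmod A))%VS.
have FH : (F <= H)%VS by apply: precomp_sub.
(* The map [pi] must be defined on all K-linear maps. Killing a complement of [H] along with [F]
   keeps [pi] surjective on [H], with kernel exactly [F] there. *)
have [T [pi [pis kpi]]] := quotient_vect (F + H^C)%VS.
have kerE h : is_hom h ->
    (pi h = 0 <-> exists2 k : 'Hom(P0, regmod A), is_hom k & h = (k \o f)%VF).
  move=> hh; have hH : h \in H by apply/homvP.
  have -> : (pi h = 0) <-> h \in F.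
    have -> : F = ((F + H^C) :&: H)%VS by rewrite -vspace_modl // capvC capv_compl addv0.
    by rewrite memv_cap hH andbT -kpi memv_ker; split=> [->|/eqP].
  split=> [/memv_imgP[k /homvP hk]|[k /homvP hk ->]]; last by rewrite -precompE memv_img.
  by rewrite precompE; exists k.
have piH : (pi @: H)%VS = fullv.
  have H0 : (pi @: H^C = 0)%VS by apply/eqP; rewrite -lkerE kpi addvSr.
  by rewrite -pis -(addv_complf H) limgD H0 addv0.
have [s sP] := linear_section piH.
have hs l : is_hom (s l) by apply/homvP; case: (sP l).
have pi_s l : pi (s l) = l by case: (sP l).
pose act (a : A) (t : T) : T := pi (hom_reg_lact a (s t)).
have pi_act a h : is_hom h -> pi (hom_reg_lact a h) = act a (pi h).
  move=> hh; apply/eqP; rewrite -subr_eq0 -linearB.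
  have [|k hk E] := (kerE (h - s (pi h)) ltac:(by auto)).1.
    by rewrite linearB /= pi_s subrr.
  have -> : hom_reg_lact a h - hom_reg_lact a (s (pi h)) = hom_reg_lact a (h - s (pi h)).
    by rewrite /hom_reg_lact comp_lfunDr comp_lfunNr.
  rewrite E -hom_reg_lact_comp; apply/eqP/kerE.
    by apply: is_hom_comp => //; apply: is_hom_reg_lact.
  by exists (hom_reg_lact a k) => //; apply: is_hom_reg_lact.
have l1 t : linear (act^~ t) by move=> k a b; rewrite /act hom_reg_lact_linearl linearP.
have l2 a : linear (act a) by move=> k t t'; rewrite /act linearP hom_reg_lact_linearr linearP.
have a1 t : act 1 t = t by rewrite /act hom_reg_lact1 pi_s.
have aM a b t : act (a * b) t = act a (act b t).
  by rewrite /act hom_reg_lactM pi_act //; apply: is_hom_reg_lact.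
exists (LMod l1 l2 a1 aM), pi; split=> // l; by exists (s l).
Qed.

Lemma hom_zero_iso X T T' : iso_mod T T' -> hom_zero X T -> hom_zero X T'.
Proof.
move=> /iso_modP[i [j [hi hj ji ij]]] h0 h hh.
by rewrite -[h]comp_lfun1l -ij -comp_lfunA (h0 _ (is_hom_comp hj hh)) comp_lfun0r.
Qed.

Lemma tau_presentation M T : is_tau M T ->
  exists P1 P0 (f : 'Hom(P1, P0)) (g : 'Hom(P0, M)),
    [/\ presentation f g, superfluous (lker f) & forall X, hom_zero X T <-> extfree f X].
Proof.
move=> [L [P1 [P0 [f [g [mp [pi [s l k]]]]]]] TL].
have [[pP1 pP0] [hf hg] fg _ sf] := mp.
exists P1, P0, f, g; split=> // X; split.
  by move=> /(hom_zero_iso TL); apply: (transpose_extfree pP1 s l k).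
move=> ext; apply: (hom_zero_iso (iso_sym TL)).
exact: (extfree_transpose pP1 pP0 hf s l k).
Qed.

Definition ext_rigid M : Prop := exists P1 P0 (f : 'Hom(P1, P0)) (g : 'Hom(P0, M)),
  [/\ presentation f g, superfluous (lker f) & extfree f M].

(** Being [extfree] passes from one presentation of [M] to a minimal one, by [extfree_retract] for
    the identity of [M]. *)
Lemma tau_rigidP M : tau_rigid M <-> ext_rigid M.
Proof.
split=> [[T /tau_presentation[P1 [P0 [f [g [p s E]]]]] /E e]|]; first by exists P1, P0, f, g.
move=> [Q1 [Q0 [f' [g' [p' _ e']]]]].
have [P1 [P0 [f [g mp]]]] := minimal_presentation_exists M.
have [[pP1 pP0] [hf hg] fg _ sf] := mp.
have [L [pi [s l k]]] := transpose_exists hf.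
exists (dual_mod L); last first.
  apply: (extfree_transpose pP1 pP0 hf s l k).
  apply: extfree_retract p' (minimal_presentation mp) sf e'.
  exact/iso_retract/iso_refl.
exists L; last exact: iso_refl.
by exists P1, P0, f, g; split=> //; exists pi.
Qed.

(** * Torsion classes *)

Lemma epi_corestrict X Y Z (f : 'Hom(X, Y)) (i : 'Hom(Z, Y)) :
    is_hom f -> is_hom i -> mono i -> limg i = limg f ->
  exists p : 'Hom(X, Z), [/\ is_hom p, epi p & (i \o p)%VF = f].
Proof.
move=> hf hi mi iE; have [|p hp ip] := factor_mono hi mi hf; first by rewrite iE.
exists p; split=> //; apply/limg_fullP => z.
have : i z \in limg f by rewrite -iE memv_limg.
by case/memv_imgP=> x _; rewrite -ip comp_lfunE => /((lker0_inj i).1 mi) ->; exists x.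
Qed.

Lemma torsion_class_dsum (C : mod_class A) X Y :
  torsion_class C -> C X -> C Y -> C (dsum X Y).
Proof. by move=> [_ ext] CX CY; apply: ext (short_exact_dsum X Y) CX CY. Qed.

Lemma torsion_class_gen (C : mod_class A) N X : torsion_class C -> C N -> gen N X -> C X.
Proof.
move=> tC CN /genP[k]; apply: (tC.1); elim: k => [|k IH] /=; last exact: torsion_class_dsum.
apply: (tC.1 _ _ CN); exists 0; split; first exact: is_hom0.
by apply/limg_fullP => x; exists 0; rewrite zero_lfunE; apply: (@zero_mod_zero x).
Qed.

Lemma tors_torsion N : torsion_class (tors N).
Proof.
split=> [X Y tX qXY C tC CN|X Y Z f g fg tX tZ C tC CN].
  by apply: (tC.1 X Y _ qXY); apply: tX.
by apply: (tC.2 X Y Z f g fg); [apply: tX|apply: tZ].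
Qed.

Lemma tors_refl N : tors N N.
Proof. by move=> C _. Qed.

Lemma left_finite_gen N : left_finite N ->
  exists2 M, torsion_class (gen M) & forall X, tors N X <-> gen M X.
Proof.
move=> [M E]; have E' X : tors N X <-> gen M X by rewrite -Fac_gen.
exists M => //; have [tq te] := tors_torsion N; split.
  by move=> X Y /E' tX q; apply/E'; apply: tq q.
by move=> X Y Z f g fg /E' tX /E' tZ; apply/E'; apply: te fg _ _.
Qed.

Lemma ext_rigid_torsion M : ext_rigid M -> torsion_class (gen M).
Proof. by move=> [P1 [P0 [f [g [p _ e]]]]]; apply: gen_torsion p e. Qed.

Lemma tors_gen M X : torsion_class (gen M) -> tors M X <-> gen M X.
Proof.
move=> tM; split=> [tX|gX C tC CM]; first by apply: tX => //; apply: gen_refl.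
exact: torsion_class_gen gX.
Qed.

Lemma ext_rigid_left_finite M : ext_rigid M -> left_finite M.
Proof. by move=> /ext_rigid_torsion tM; exists M => X; rewrite tors_gen // Fac_gen. Qed.

(** The modules all of whose maps to [S] are zero or surjective form a torsion class: on an
    extension, a map that vanishes on the submodule factors through the quotient. For a brick, [S]
    belongs to it. *)
Lemma brick_hom S X (f : 'Hom(X, S)) : brick S -> tors S X -> is_hom f -> f = 0 \/ epi f.
Proof.
move=> [nzS bS] tX; apply: (tX (fun X => forall f : 'Hom(X, S), is_hom f -> f = 0 \/ epi f)).
  split=> {X f tX} [X Y hX [p [hp ep]] f hf|X Y Z a b [[ha hb] ma ab eb] hX hZ f hf].
    case: (hX _ (is_hom_comp hf hp)) => [fp0|efp]; [left|right].
      by apply: (epi_comp_inj ep); rewrite fp0 comp_lfun0l.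
    by apply/eqP; rewrite eqEsubv subvf /= -efp limg_comp limgS ?subvf.
  case: (hX _ (is_hom_comp hf ha)) => [fa0|efa]; last first.
    by right; apply/eqP; rewrite eqEsubv subvf /= -efa limg_comp limgS ?subvf.
  have [|h hh <-] := factor_epi hb eb hf; first by rewrite -ab limg_sub_ker.
  by case: (hZ h hh) => [->|eh]; [left; rewrite comp_lfun0l|right; apply: comp_lfun_epi].
move=> g hg; have [->|/eqP ng] := eqVneq g 0; [by left|right].
by have [g' [_ _ gg']] := bS g hg ng; apply: section_epi gg'.
Qed.

(** The modules without nonzero quotients that receive only zero maps from [U] form a torsion class
    containing [U]. *)
Lemma tors_hom U X : tors U X -> hom_zero U X -> is_zero X.
Proof.
move=> tX h0; apply: (tX (fun X => forall Y, quotient_of X Y -> hom_zero U Y -> is_zero Y)) => //.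
- split=> {X tX h0} [X Y hX [p [hp ep]] Z [q [hq eq]]|
    X Y Z a b [[ha hb] ma ab eb] hX hZ Q [q [hq eq]] h0].
    by apply: hX; exists (q \o p)%VF; split; auto; apply: comp_lfun_epi.
  have hqa := is_hom_comp hq ha.
  have [I [i [hi mi iE]]] := submodule_exists (is_submod_limg hqa).
  have [p [hp ep ip]] := epi_corestrict hqa hi mi iE.
  have zI : is_zero I.
    apply: hX; first by exists p.
    by move=> h hh; apply: (mono_comp_inj mi); rewrite comp_lfun0r (h0 _ (is_hom_comp hi hh)).
  have qa0 : (q \o a = 0)%VF.
    by rewrite -ip; apply/lfunP => x; rewrite comp_lfunE (zI (p x)) linear0 zero_lfunE.
  have [|h hh hb'] := factor_epi hb eb hq; first by rewrite -ab limg_sub_ker.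
  apply: hZ h0; exists h; split=> //.
  by apply/eqP; rewrite eqEsubv subvf /= -eq -hb' limg_comp limgS ?subvf.
- move=> Y [p [hp ep]] h0Y y; have [x ->] := (limg_fullP p).1 ep y.
  by rewrite (h0Y p hp) zero_lfunE.
- by exists \1%VF; split; rewrite // /epi lim1g.
Qed.

(** There are nonzero maps in both directions by [tors_hom]; both are surjective by [brick_hom], so
    the dimensions agree. *)
Lemma brick_iso U V : same_class (tors U) (tors V) -> brick U -> brick V -> iso_mod U V.
Proof.
move=> E bU bV; have tUV : tors U V := (E V).2 (@tors_refl V).
have tVU : tors V U := (E U).1 (@tors_refl U).
have ex X Y : tors X Y -> ~ is_zero Y -> exists2 f : 'Hom(X, Y), is_hom f & f <> 0.
  move=> tXY nzY; apply: contrapT => nf; apply: nzY; apply: (tors_hom tXY) => f hf.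
  by apply: contrapT => f0; apply: nf; exists f.
have [f hf nf] := ex _ _ tUV bV.1; have [g hg ng] := ex _ _ tVU bU.1.
have [//|ef] := brick_hom bV tVU hf; have [//|eg] := brick_hom bU tUV hg.
exists f; split=> //; apply: epi_dim_mono => //.
by rewrite -eg -[X in (_ <= X)%N](limg_ker_dim g) capfv leq_addl.
Qed.

Lemma hom_zero_gen N M X : gen N M -> hom_zero N X -> hom_zero M X.
Proof.
move=> gM h0 h hh; apply/lfunP => m; rewrite zero_lfunE; apply/eqP; rewrite -memv_ker.
rewrite (gM (lker h)) ?memvf // => g hg; apply: limg_sub_ker; exact: h0 (is_hom_comp hh hg).
Qed.

(* The summand is that of a minimal left approximation of [A], which is split
   projective for both generators. *)
Lemma common_summand N N' : ~ is_zero N -> (forall X, gen N X <-> gen N' X) ->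
  exists T, [/\ indecomposable T, retract T N & retract T N'].
Proof.
move=> nzN E; have [T0 [phi [[hphi gT0 aphi] spl]]] := minimal_left_approximation N.
have nzT0 : ~ is_zero T0.
  move=> zT0; have /not_zeroP[x /eqP nx] := nzN; apply: nx.
  have [k hk kphi] := aphi _ _ (is_hom_orbit x) (@gen_refl N).
  by rewrite -[x]ract1 -orbit_mapE -kphi comp_lfunE (zT0 (phi _)) linear0.
have [T iT rT] := exists_indecomposable_retract nzT0.
have sum_retract M : (forall X, gen N X <-> gen M X) -> retract T M.
  move=> EM; have [k [p [hp ep]]] := (genP M T0).1 ((EM _).1 gT0).
  have [|s hs ps] := spl _ _ hp ep; first by apply/EM; apply: gen_nseq; apply: gen_refl.
  have rTk : retract T (dsums (nseq k M)) by apply: retract_trans rT _; exists s, p.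
  have Ek : nseq k M = [seq (fun=> M) i | i <- nseq k tt] by rewrite map_nseq.
  by rewrite Ek in rTk; have [] := indecomposable_retract_dsums iT rTk.
by exists T; split=> //; apply: sum_retract.
Qed.

Lemma indecomposable_gen_iso U V : indecomposable U -> indecomposable V ->
  (forall X, gen U X <-> gen V X) -> iso_mod U V.
Proof.
move=> iU iV E; have [T [iT rU rV]] := common_summand iU.1 E.
apply: iso_trans (retract_indecomposable iT.1 iV rV).
exact: iso_sym (retract_indecomposable iT.1 iU rU).
Qed.

Section SumPresentation.
Variables (P1 P0 M Q1 Q0 N : rmod A).
Variables (f : 'Hom(P1, P0)) (g : 'Hom(P0, M)) (f' : 'Hom(Q1, Q0)) (g' : 'Hom(Q0, N)).

Definition dsum_map X X' Y Y' (a : 'Hom(X, Y)) (b : 'Hom(X', Y')) :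
    'Hom(dsum X X', dsum Y Y') :=
  copair (dinl Y Y' \o a)%VF (dinr Y Y' \o b)%VF.

Lemma dsum_mapE X X' Y Y' (a : 'Hom(X, Y)) (b : 'Hom(X', Y')) x y :
  dsum_map a b (x, y) = (a x, b y).
Proof.
rewrite copairE !comp_lfunE dinlE dinrE.
by apply/pair_equal_spec; rewrite /= addr0 add0r.
Qed.

Lemma presentation_dsum :
  presentation f g -> presentation f' g' -> presentation (dsum_map f f') (dsum_map g g').
Proof.
move=> [[pP1 pP0] [hf hg] [fg eg]] [[pQ1 pQ0] [hf' hg'] [fg' eg']]; split.
- by split; apply: projective_dsum.
- by split; apply: is_hom_copair; auto.
split; last first.
  apply/limg_fullP => -[x y]; have [x' ->] := (limg_fullP g).1 eg x.
  by have [y' ->] := (limg_fullP g').1 eg' y; exists (x', y'); rewrite dsum_mapE.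
apply/vspaceP => -[x y]; rewrite memv_ker dsum_mapE; apply/memv_imgP/eqP.
  move=> [[x' y'] _]; rewrite dsum_mapE => -[-> ->]; rewrite -!comp_lfunE.
  by rewrite !limg_sub_kerP ?fg ?fg' // !zero_lfunE.
move=> [/eqP]; rewrite -memv_ker -fg => /memv_imgP[x' _ ->] /eqP.
rewrite -memv_ker -fg' => /memv_imgP[y' _ ->].
by exists (x', y'); rewrite ?memvf ?dsum_mapE.
Qed.

Lemma extfree_dsum_map X : extfree f X -> extfree f' X -> extfree (dsum_map f f') X.
Proof.
move=> e e' h hh; have [k hk E] := e _ (is_hom_comp hh (@is_hom_dinl _ _)).
have [k' hk' E'] := e' _ (is_hom_comp hh (@is_hom_dinr _ _)).
exists (copair k k'); first exact: is_hom_copair.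
by apply: dsum_ext; rewrite -comp_lfunA ?copair_inl ?copair_inr comp_lfunA ?copair_inl ?copair_inr.
Qed.

End SumPresentation.

(** Each of [f] and [f'] is ext-free on both [U] and [V], because these generate each other. So the
    sum of the presentations is ext-free on [dsum U V], and this is transferred to a minimal
    presentation. *)
Lemma ext_rigid_dsum U V : (forall X, gen U X <-> gen V X) ->
  ext_rigid U -> ext_rigid V -> ext_rigid (dsum U V).
Proof.
move=> E [P1 [P0 [f [g [p _ e]]]]] [Q1 [Q0 [f' [g' [p' _ e']]]]].
have gUV : gen U V by apply/E/gen_refl.
have gVU : gen V U by apply/E/gen_refl.
have eUV : extfree f (dsum U V).
  by apply: extfree_dsum => //; apply: extfree_gen gUV => //; case: p => -[].
have eVU : extfree f' (dsum U V).
  by apply: extfree_dsum => //; apply: extfree_gen gVU => //; case: p' => -[].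
have [R1 [R0 [h [k mp]]]] := minimal_presentation_exists (dsum U V).
have sh : superfluous (lker h) by case: mp.
exists R1, R0, h, k; split=> //; first exact: minimal_presentation.
apply: (extfree_retract _ (presentation_dsum p p') (minimal_presentation mp) sh).
  exact/iso_retract/iso_refl.
exact: extfree_dsum_map.
Qed.

(* [F] is the quotient of [X] by the trace of [N]. *)
Lemma torsion_pair N X : torsion_class (gen N) ->
  exists2 F, quotient_of X F & hom_zero N F /\ (is_zero F -> gen N X).
Proof.
move=> tN; have [Y [i [hi mi gY imax]]] := trace_submodule N X.
have [F [p [hp ep kp]]] := quotient_exists (is_submod_limg hi).
exists F; first by exists p.
split=> [h hh|zF]; last first.
  apply: gen_quotient gY _; exists i; split=> //; rewrite /epi -kp.
  by apply/vspaceP => x; rewrite memv_ker (zF (p x)) memvf eqxx.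
(* Let [I] be the trace of [N] in [F] and [Z] its preimage in [X]. As an extension of [I] by [Y],
   [Z] is generated by [N], hence lies in the trace [limg i]; so every map from [N] to [F] is
   zero. *)
have [I [j [hj mj gI jmax]]] := trace_submodule N F.
have [Z [z [hz mz zE]]] := submodule_exists (is_submod_preim hp (is_submod_limg hj)).
have zP x : (p x \in limg j) = (x \in limg z) by rewrite zE memv_preim.
have pi0 : (p \o i = 0)%VF by apply: limg_sub_kerP; rewrite kp.
have [|i' hi' zi'] := factor_mono hz mz hi.
  by apply/subvP => _ /memv_imgP[y _ ->]; rewrite -zP -comp_lfunE pi0 zero_lfunE mem0v.
have [||p' hp' jp'] := @factor_mono _ _ _ j (p \o z)%VF hj mj; auto.
  by apply/subvP => _ /memv_imgP[w _ ->]; rewrite comp_lfunE zP memv_limg.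
have jp'E w : j (p' w) = p (z w) by rewrite -!comp_lfunE jp'.
have gZ : gen N Z.
  apply: (tN.2 Y Z I i' p'); last by [].
    split=> //.
    - by apply/lker0_inj => x y /(congr1 z); rewrite -!comp_lfunE zi' => /((lker0_inj i).1 mi).
    - apply/vspaceP => w; rewrite memv_ker -(mono_eq0 _ mj) jp'E -memv_ker kp.
      apply/memv_imgP/memv_imgP => -[y yf E]; exists y => //.
        by rewrite E -comp_lfunE zi'.
      by apply: ((lker0_inj z).1 mz); rewrite E -zi' comp_lfunE.
    - apply/limg_fullP => y; have [x E] := (limg_fullP p).1 ep (j y).
      have : x \in limg z by rewrite -zP -E memv_limg.
      case/memv_imgP=> w _ xw; exists w; apply: ((lker0_inj j).1 mj).
      by rewrite jp'E E xw.
  exact: gY.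
have zi : (limg z <= limg i)%VS.
  have Ef : (z @^-1: limg i)%VS = fullv.
    apply: gZ => g hg; apply/subvP => _ /memv_imgP[m _ ->].
    rewrite -memv_preim -comp_lfunE; apply: (subvP (imax _ (is_hom_comp hz hg))).
    exact: memv_limg.
  by apply/subvP => _ /memv_imgP[w _ ->]; rewrite memv_preim Ef memvf.
apply/lfunP => n; rewrite zero_lfunE; apply/eqP; have [x E] := (limg_fullP p).1 ep (h n).
rewrite E -memv_ker kp; apply: (subvP zi); rewrite -zP -E.
by apply: (subvP (jmax h hh)); apply: memv_limg.
Qed.

Lemma simple_epi X Z (g : 'Hom(X, Z)) : simple_mod Z -> is_hom g -> g <> 0 -> epi g.
Proof.
move=> [_ sZ] hg ng; case: (sZ _ (is_submod_limg hg)) => // E; case: ng.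
by apply/lfunP => x; rewrite zero_lfunE; apply/eqP; rewrite -memv0 -E memv_limg.
Qed.

Lemma epi_neq0 X Z (g : 'Hom(X, Z)) : ~ is_zero Z -> epi g -> g <> 0.
Proof.
by move=> nz eg g0; apply: nz => z; have [x ->] := (limg_fullP g).1 eg z; rewrite g0 zero_lfunE.
Qed.

Lemma superfluous_epi X Y Z (a : 'Hom(X, Y)) (g : 'Hom(Y, Z)) :
  is_hom a -> is_hom g -> superfluous (lker g) -> epi (g \o a)%VF -> epi a.
Proof.
move=> ha hg sg ega; apply: sg; first exact: is_submod_limg.
apply/vspaceP => y; rewrite memvf; have [x E] := (limg_fullP _).1 ega (g y).
rewrite -[y](subrK (a x)) addrC memv_add ?memv_limg // memv_ker linearB /= E comp_lfunE.
by rewrite subrr.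
Qed.

(** * Projective covers of simple modules *)

Section SimpleTop.
Variables (P Z : rmod A) (g : 'Hom(P, Z)).
Hypotheses (sZ : simple_mod Z) (hg : is_hom g) (eg : epi g) (sg : superfluous (lker g)).

Lemma simple_top_indecomposable : indecomposable P.
Proof.
split=> [zP|X Y /iso_sym/iso_modP[e [e' [he he' e'e ee']]]].
  apply: (epi_neq0 sZ.1 eg); apply/lfunP => x.
  by rewrite (zP x) !linear0.
have e_inj x y : e x = e y -> x = y.
  by move=> E; rewrite -[x]id_lfunE -e'e comp_lfunE E -comp_lfunE e'e id_lfunE.
have [gl0|nl] := pselect ((g \o e) \o dinl X Y = 0)%VF; [left|right].
  have er : epi ((g \o e) \o dinr X Y)%VF.
    apply: simple_epi; auto => gr0; apply: (epi_neq0 sZ.1 eg).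
    rewrite -[g]comp_lfun1r -ee' comp_lfunA -[(g \o e)%VF]comp_lfun1r -dsum_id comp_lfunDr.
    by rewrite !comp_lfunA gl0 gr0 !comp_lfun0l addr0 comp_lfun0l.
  have er' : epi (e \o dinr X Y)%VF.
    by apply: (superfluous_epi _ hg sg); [auto|rewrite comp_lfunA].
  move=> x; have [y] := (limg_fullP _).1 er' (e (x, 0)).
  by rewrite comp_lfunE dinrE => /e_inj[].
have el : epi ((g \o e) \o dinl X Y)%VF by apply: simple_epi; auto.
have el' : epi (e \o dinl X Y)%VF.
  by apply: (superfluous_epi _ hg sg); [auto|rewrite comp_lfunA].
move=> y; have [x] := (limg_fullP _).1 el' (e (0, y)).
by rewrite comp_lfunE dinlE => /e_inj[].
Qed.

(** The image of [lker g'] under [g] is zero or everything. The latter would force [lker g'] to be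
    all of [P]; the former gives a map between the simple modules. *)
Lemma simple_top_unique Z' (g' : 'Hom(P, Z')) :
  simple_mod Z' -> is_hom g' -> epi g' -> iso_mod Z Z'.
Proof.
move=> sZ' hg' eg'; have sk := is_submod_lker hg'.
case: (sZ.2 _ (is_submod_img hg sk)) => E; last first.
  have kf : lker g' = fullv.
    apply: sg => //; apply/vspaceP => x; rewrite memvf.
    have : g x \in (g @: lker g')%VS by rewrite E memvf.
    case/memv_imgP=> y yk gxy; rewrite -[x](subrK y) addrC memv_add // memv_ker.
    by rewrite linearB /= gxy subrr.
  case: (epi_neq0 sZ'.1 eg'); apply/lfunP => x; apply/eqP.
  by rewrite zero_lfunE -memv_ker kf memvf.
have [|u hu ug] := factor_epi hg' eg' hg; first by rewrite lkerE E.
have eu : epi u by apply/eqP; rewrite eqEsubv subvf /= -eg -ug limg_comp limgS ?subvf.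
apply: iso_sym; exists u; split=> //.
case: (sZ'.2 _ (is_submod_lker hu)) => // ku; case: (epi_neq0 sZ.1 eu).
by apply/lfunP => x; apply/eqP; rewrite zero_lfunE -memv_ker ku memvf.
Qed.

Lemma simple_top_summand : projective_mod P -> retract P (regmod A).
Proof.
move=> pP; have /not_zeroP[x /eqP nx] := sZ.1.
have ex : epi (orbit_map x).
  apply: simple_epi; auto => /lfunP/(_ 1); rewrite orbit_mapE ract1 zero_lfunE; exact: nx.
have [l hl E] := @projective_regmod _ _ g (orbit_map x) hg eg (is_hom_orbit x).
have el : epi l by apply: (superfluous_epi hl hg sg); rewrite -E.
by have [s hs ls] := split_epi_projective pP hl el; exists s, l.
Qed.

End SimpleTop.

(** Projective covers of distinct simple modules are non-isomorphic indecomposable summands of the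
    regular module. *)
Lemma simple_reps_le n (S : 'I_n -> rmod A) a :
  simple_reps S -> num_summands (regmod A) a -> (n <= a)%N.
Proof.
move=> [sS nS _] [Z [_ nZ exh]].
have /choice[k hk] : forall i, exists k, exists P (g : 'Hom(P, S i)),
    [/\ is_hom g, epi g, superfluous (lker g) & iso_mod P (Z k)].
  move=> i; have [P [g [pP hg eg sg]]] := projective_cover_exists (S i).
  have [k Pk] := exh P (simple_top_indecomposable (sS i) hg eg sg)
    ((direct_summandP _ _).2 (simple_top_summand (sS i) hg eg sg pP)).
  by exists k, P, g.
suff /leq_card : injective k by rewrite !card_ord.
move=> i j kij; have [P [g [hg eg sg PZ]]] := hk i; have [Q [h [hh eh _ QZ]]] := hk j.
rewrite kij in PZ; have [u [hu mu eu]] := iso_trans PZ (iso_sym QZ).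
apply: nS; apply: (simple_top_unique (sS i) hg eg sg (sS j) (is_hom_comp hh hu)).
exact: comp_lfun_epi.
Qed.

(** * Functionals cutting out torsion classes *)

Section Independence.
Variables (R : realType) (m : nat) (N : 'I_m -> rmod A).
Hypotheses (iN : forall i, indecomposable (N i)) (nN : pairwise_noniso N).

Definition sub_sum (p : pred 'I_m) : rmod A := dsums [seq N i | i <- [seq i <- enum 'I_m | p i]].

Lemma retract_sub_sum (p : pred 'I_m) i : p i -> retract (N i) (sub_sum p).
Proof. by move=> pi; apply: retract_dsums; rewrite mem_filter pi mem_enum. Qed.

Lemma gen_sub_sum (p q : pred 'I_m) :
  (forall i, q i -> gen (sub_sum p) (N i)) -> gen (sub_sum p) (sub_sum q).
Proof. by move=> h; apply: gen_dsums => i; rewrite mem_filter => /andP[/h]. Qed.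

(* For the trace [I] of the positive part in [N j], passing from [N j] to [I] does
   not change the positive part of the relation, hence not the negative one. *)
Lemma positive_part_gen (c : 'I_m -> R) j :
    (forall X, gen (sub_sum predT) X -> \sum_i c i * (dimHom (N i) X)%:R = 0) ->
    c j < 0 -> gen (sub_sum (fun i => 0 < c i)) (N j).
Proof.
move=> rel cj; set Np := sub_sum _; have [I [i [hi mi gI imax]]] := trace_submodule Np (N j).
have gT p X : gen (sub_sum p) X -> gen (sub_sum predT) X.
  by apply: gen_trans; apply: gen_sub_sum => k _; apply/gen_retract/retract_sub_sum.
have rI := rel I (gT _ _ gI).
have rj : \sum_i c i * (dimHom (N i) (N j))%:R = 0.
  by apply: rel; apply/gen_retract/retract_sub_sum.
have pos k : 0 < c k -> dimHom (N k) I = dimHom (N k) (N j).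
  move=> ck; apply/(dimHom_mono_eq _ hi mi) => g hg.
  have [a [b [ha hb ba]]] : retract (N k) Np by apply: retract_sub_sum.
  have -> : g = ((g \o b) \o a)%VF by rewrite -comp_lfunA ba comp_lfun1r.
  by apply: subv_trans (imax _ (is_hom_comp hg hb)); rewrite limg_comp limgS ?subvf.
have eqj : dimHom (N j) I = dimHom (N j) (N j).
  (* All terms of this sum are nonnegative: a positive [c k] meets a zero difference, a negative one
     a difference that is at most zero. So each term vanishes, and [c j] is nonzero. *)
  have : \sum_k c k * ((dimHom (N k) I)%:R - (dimHom (N k) (N j))%:R) = 0.
    by under eq_bigr do rewrite mulrBr; rewrite sumrB rI rj subrr.
  move/psumr_eq0P => z; have := z _ j isT; move/(_ _)/eqP.
  rewrite mulf_eq0 lt_eqF //= subr_eq0 eqr_nat => h; apply/eqP; apply: h => k _.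
  have [ck|ck|<-] := ltgtP 0 (c k); last by rewrite mul0r.
    by rewrite pos // subrr mulr0.
  by apply: mulr_le0; rewrite ?subr_le0 ?ler_nat ?(dimHom_mono _ hi) // ltW.
apply: gen_quotient gI _; exists i; split=> //.
have /(_ \1%VF (@is_hom_id _)) := (dimHom_mono_eq (N j) hi mi).1 eqj.
by rewrite lim1g => le; apply/eqP; rewrite eqEsubv subvf.
Qed.

(** Applied to [c] and [- c], the previous lemma shows that the positive and negative parts generate
    each other. If [c] is nonzero they share an indecomposable summand, so some [N k] with [c k > 0]
    is isomorphic to some [N l] with [c l < 0]. *)
Lemma dimHom_independent (c : 'I_m -> R) :
    (forall X, gen (sub_sum predT) X -> \sum_i c i * (dimHom (N i) X)%:R = 0) ->
  forall i, c i = 0.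
Proof.
move=> rel i; apply: contrapT => /eqP ci.
pose p k := 0 < c k; pose q k := c k < 0.
have gpq : gen (sub_sum p) (sub_sum q) by apply: gen_sub_sum => k; apply: positive_part_gen.
have gqp : gen (sub_sum q) (sub_sum p).
  apply: gen_sub_sum => k ck; have -> : q = (fun k => 0 < - c k).
    by apply/funext => l; rewrite oppr_gt0.
  apply: (@positive_part_gen (fun k => - c k)); last by rewrite oppr_lt0.
  move=> X /rel E; under eq_bigr do rewrite mulNr.
  by rewrite sumrN E oppr0.
have E X : gen (sub_sum p) X <-> gen (sub_sum q) X by split; apply: gen_trans.
have nz (r : pred 'I_m) : r i -> ~ is_zero (sub_sum r).
  by move=> ri; have := retract_sub_sum ri; move=> /retract_is_zero h /h; case: (iN i).
have [T [iT rp rq]] : exists T,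
    [/\ indecomposable T, retract T (sub_sum p) & retract T (sub_sum q)].
  move: ci; rewrite neq_lt => /orP[ci|ci].
    have [|T [iT rq rp]] := @common_summand (sub_sum q) (sub_sum p) (nz q ci).
      by move=> X; rewrite E.
    by exists T.
  exact: common_summand (nz p ci) E.
have [k] := indecomposable_retract_dsums iT rp; rewrite mem_filter => /andP[pk _] rk.
have [l] := indecomposable_retract_dsums iT rq; rewrite mem_filter => /andP[ql _] rl.
have kl : k = l.
  apply: nN; apply: iso_trans (retract_indecomposable iT.1 (iN l) rl).
  exact: iso_sym (retract_indecomposable iT.1 (iN k) rk).
by move: pk; rewrite /p kl ltNge ltW.
Qed.

End Independence.

(** * Torsion classes as semistable classes *)

Section Semistable.
Variables (R : realType) (n : nat) (S : 'I_n -> rmod A).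
Hypothesis S_simples : simple_reps S.

Definition hom_vec P : 'rV[R]_n := \row_i (dimHom P (S i))%:R.

Lemma pairing_hom_vec P X : projective_mod P -> pairing S (hom_vec P) X = (dimHom P X)%:R.
Proof.
move=> pP; rewrite (dimHom_dimvec S_simples X pP) natr_sum; apply: eq_bigr => i _.
by rewrite mxE natrM.
Qed.

Lemma pairingD (d e : 'rV[R]_n) X : pairing S (d + e) X = pairing S d X + pairing S e X.
Proof. by rewrite -big_split; apply: eq_bigr => i _ /=; rewrite mxE mulrDl. Qed.

Lemma pairingB (d e : 'rV[R]_n) X : pairing S (d - e) X = pairing S d X - pairing S e X.
Proof. by rewrite -sumrB; apply: eq_bigr => i _ /=; rewrite !mxE mulrBl. Qed.

(** A semistable [X] has a nonnegative value on its torsion-free quotient [F], which forces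
    [F = 0]. *)
Lemma gen_semistable N (delta : 'rV[R]_n) : torsion_class (gen N) ->
    (forall X, gen N X -> 0 <= pairing S delta X) ->
    (forall F, hom_zero N F -> 0 <= pairing S delta F -> is_zero F) ->
  forall X, gen N X <-> semistable_torsion S delta X.
Proof.
move=> tN pos neg X; split=> [gX Y qY|sX]; first by apply: pos; apply: gen_quotient qY.
by have [F qF [h0 zF]] := torsion_pair X tN; apply: zF; apply: neg => //; apply: sX.
Qed.

(* Let [A -> T0] be a minimal left approximation with cokernel [T1], and
   [P1 -> P0 -> T0] a minimal presentation.  Then [A + P1 -> P0] presents [T1], both
   presentations are ext-free on the torsion class, and [dim F = dim Hom(A, F)]
   is the difference of the two associated functionals; hence their sum is
   strictly negative on nonzero torsion-free modules [F]. *)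
Lemma torsion_gen_semistable N : torsion_class (gen N) ->
  exists delta : 'rV[R]_n, forall X, gen N X <-> semistable_torsion S delta X.
Proof.
move=> tN; have [T0 [phi [[hphi gT0 aphi] spl]]] := minimal_left_approximation N.
have [P1 [P0 [f [g mp]]]] := minimal_presentation_exists T0.
have pres := minimal_presentation mp; have sf : superfluous (lker f) by case: mp.
have [[pP1 pP0] [hf hg] [fg eg]] := pres.
have [T1 [c [hc ec kc]]] := quotient_exists (is_submod_limg hphi).
have [a ha ga] := @projective_regmod _ _ g phi hg eg hphi.
have gf0 : (g \o f = 0)%VF by apply: limg_sub_kerP; rewrite fg.
have pA := @projective_regmod.
have pAP := projective_dsum pA pP1.
have pres1 : presentation (copair a f) (c \o g)%VF.
  split; auto; split; last exact: comp_lfun_epi.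
  rewrite limg_copair; apply/eqP; rewrite eqEsubv subv_add -andbA; apply/and3P; split.
  - by apply: limg_sub_ker; rewrite -comp_lfunA -ga; apply: limg_sub_kerP; rewrite kc.
  - by apply: limg_sub_ker; rewrite -comp_lfunA gf0 comp_lfun0r.
  - apply/subvP => x; rewrite memv_ker comp_lfunE -memv_ker kc => /memv_imgP[b _ gx].
    rewrite -[x](subrK (a b)) addrC memv_add ?memv_limg // fg memv_ker linearB /= gx ga.
    by rewrite comp_lfunE subrr.
have ef X : gen N X -> extfree f X by apply: split_projective_extfree spl pres sf.
(* The [P1] component is extended first, by [k']. What remains on the regular module factors through
   [phi = g \o a], and the correction [k \o g] vanishes on [f]. *)
have ef1 X : gen N X -> extfree (copair a f) X.
  move=> gX h hh; have [k' hk' k'f] := ef X gX _ (is_hom_comp hh (@is_hom_dinr _ _)).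
  have hA : is_hom ((h \o dinl _ _) - (k' \o a))%VF by auto.
  have [k hk kphi] := aphi X _ hA gX.
  exists (k' + (k \o g))%VF; first by auto.
  apply: dsum_ext; rewrite -comp_lfunA ?copair_inl ?copair_inr comp_lfunDl -comp_lfunA.
    by rewrite -ga kphi addrC subrK.
  by rewrite gf0 comp_lfun0r addr0 k'f.
exists (hom_vec P0 - hom_vec P1 + (hom_vec P0 - hom_vec (dsum (regmod A) P1))).
apply: gen_semistable => // [X gX|F h0]; rewrite pairingD !pairingB !pairing_hom_vec //.
  rewrite {1}((presentation_eq X pres).2 (ef X gX)) ((presentation_eq X pres1).2 (ef1 X gX)).
  by rewrite !natrD !addrK addr_ge0.
have := presentation_le F pres; rewrite ((dimHom_eq0 T0 F).2 (hom_zero_gen gT0 h0)) add0n.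
rewrite dimHom_dsum -(ler_nat R) natrD => le ge0.
have /eqP/dimHom_eq0 hA0 : dimHom (regmod A) F == 0%N.
  rewrite -(eqr_nat R); apply/eqP/le_anti; rewrite ler0n andbT.
  (* Here [x <= y] and [0 <= (x - y) + (x - (z + y))], so [z <= 0]. *)
  move: le ge0; set x := (dimHom P0 F)%:R; set y := (dimHom P1 F)%:R; set z := _%:R.
  by lra.
by move=> x; rewrite -[x]ract1 -orbit_mapE (hA0 _ (is_hom_orbit x)) zero_lfunE.
Qed.

Lemma row_full_kernel m (G : 'M[R]_(m, n)) (d : 'cV[R]_n) :
  row_free G -> (n <= m)%N -> G *m d = 0 -> d = 0.
Proof.
move=> /eqP rG le Gd; have fG : row_full G.
  by rewrite /row_full eqn_leq rank_leq_col rG le.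
by apply: (row_full_inj fG); rewrite Gd mulmx0.
Qed.

Lemma hom_zero_retract T M X : retract T M -> hom_zero M X -> hom_zero T X.
Proof. by move=> /gen_retract; apply: hom_zero_gen. Qed.

Lemma hom_zero_nseq P M k : hom_zero P M -> hom_zero P (dsums (nseq k M)).
Proof.
move=> h0; elim: k => [|k IH] h hh.
  by apply/lfunP => x; rewrite (@zero_mod_zero (h x)) zero_lfunE.
pose D := dsums (nseq k M); change (dsums _) with (dsum M D) in h.
have E : (dfst M D \o h = 0)%VF := h0 _ (is_hom_comp (@is_hom_dfst M D) hh).
have E' : (dsnd M D \o h = 0)%VF := IH _ (is_hom_comp (@is_hom_dsnd M D) hh).
by rewrite -[h]comp_lfun1l -dsum_id comp_lfunDl -!comp_lfunA E E' !comp_lfun0r addr0.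
Qed.

Lemma projective_hom_zero_gen P M X :
  projective_mod P -> hom_zero P M -> gen M X -> hom_zero P X.
Proof.
move=> pP h0 /genP[k [q [hq eq]]] h hh; have [l hl ->] := pP _ _ _ _ hq eq hh.
by rewrite (hom_zero_nseq h0 hl) comp_lfun0r.
Qed.

(** The dimension vector of [F] is orthogonal to the g-vectors of the summands of [M] and to the
    vectors [hom_vec] of those of [P]. These are at least [n] rows, and they are independent: on
    modules generated by [M] the rows from [P] vanish, which isolates the coefficients [c1]; then
    [c2] is tested on all modules. *)
Lemma tau_tilting_sincere M P P1 P0 (f : 'Hom(P1, P0)) (g : 'Hom(P0, M)) F :
    presentation f g -> extfree f M -> projective_mod P -> hom_zero P M ->
    (exists m p a, [/\ num_summands M m, num_summands P p,
                       num_summands (regmod A) a & (m + p = a)%N]) ->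
    hom_zero M F -> extfree f F -> hom_zero P F ->
  is_zero F.
Proof.
move=> pres eM pP hPM [m [p [a [[X [hX nX _]] [Y [hY nY _]] nA mpa]]]] hMF eF hPF.
have le : (n <= m + p)%N by rewrite mpa; apply: simple_reps_le S_simples nA.
have rX i : retract (X i) M by apply/direct_summandP; case: (hX i).
have rY j : retract (Y j) P by apply/direct_summandP; case: (hY j).
have pY j : projective_mod (Y j) := projective_retract (rY j) pP.
(* The g-vector of [X i] computes [dimHom (X i)] wherever [f] is ext-free, since this property
   passes to a minimal presentation of the summand. *)
have /choice[v hv] : forall i, exists v : 'rV[R]_n, forall Z, extfree f Z ->
    pairing S v Z = (dimHom (X i) Z)%:R.
  move=> i; have [Q1 [Q0 [h [k mp]]]] := minimal_presentation_exists (X i).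
  have pr := minimal_presentation mp; have [[pQ1 pQ0] _ _] := pr.
  exists (hom_vec Q0 - hom_vec Q1) => Z eZ; rewrite pairingB !pairing_hom_vec //.
  rewrite ((presentation_eq Z pr).2 _); first by rewrite natrD addrK.
  by apply: extfree_retract (rX i) pres pr _ eZ; case: mp.
pose G : 'M[R]_(m + p, n) := col_mx (\matrix_(i < m) v i) (\matrix_(j < p) hom_vec (Y j)).
pose dv Z : 'cV[R]_n := \col_i (dimvec S Z 0 i)%:R.
have mul_dv q (B : 'M[R]_(q, n)) Z i : (B *m dv Z) i 0 = pairing S (row i B) Z.
  by rewrite mxE; apply: eq_bigr => j _; rewrite !mxE.
have YdvE Z : (\matrix_(j < p) hom_vec (Y j)) *m dv Z = \col_j (dimHom (Y j) Z)%:R.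
  by apply/matrixP => j l; rewrite ord1 mul_dv rowK [RHS]mxE pairing_hom_vec.
have XdvE Z : extfree f Z -> (\matrix_(i < m) v i) *m dv Z = \col_i (dimHom (X i) Z)%:R.
  by move=> eZ; apply/matrixP => i l; rewrite ord1 mul_dv rowK [RHS]mxE hv.
have freeG : row_free G.
  apply: inj_row_free => c cG.
  have [c1 [c2 cE]] : exists c1 c2, c = row_mx c1 c2.
    by exists (lsubmx c), (rsubmx c); rewrite hsubmxK.
  have rel Z : c1 *m ((\matrix_(i < m) v i) *m dv Z) + c2 *m (\col_j (dimHom (Y j) Z)%:R) = 0.
    by rewrite -YdvE -mul_row_col -mul_col_mx -cE mulmxA cG mul0mx.
  have c10 : c1 = 0.
    apply/matrixP => l i; rewrite ord1 [RHS]mxE.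
    apply: (dimHom_independent (fun i => (hX i).1) nX (c := fun i => c1 0 i)) => Z gZ.
    have gMZ : gen M Z.
      by apply: gen_trans gZ; apply: gen_dsums => k _; apply/gen_retract.
    have eZ : extfree f Z by apply: extfree_gen gMZ => //; case: pres => -[].
    have hPZ := projective_hom_zero_gen pP hPM gMZ.
    have := rel Z; rewrite XdvE // (_ : \col_j (dimHom (Y j) Z)%:R = 0) ?mulmx0 ?addr0.
      move=> /matrixP/(_ 0 0); rewrite [LHS]mxE [RHS]mxE => E; rewrite -[RHS]E.
      by apply: eq_bigr => k _; rewrite [in RHS]mxE.
    by apply/matrixP => k r; rewrite !mxE ((dimHom_eq0 _ _).2 (hom_zero_retract (rY k) hPZ)).
  have c20 : c2 = 0.
    apply/matrixP => l i; rewrite ord1 [RHS]mxE.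
    apply: (dimHom_independent (fun i => (hY i).1) nY (c := fun i => c2 0 i)) => Z _.
    have := rel Z; rewrite c10 mul0mx add0r => /matrixP/(_ 0 0).
    rewrite [LHS]mxE [RHS]mxE => E; rewrite -[RHS]E.
    by apply: eq_bigr => k _; rewrite [in RHS]mxE.
  by rewrite cE c10 c20 row_mx0.
apply: (dimvec_zero S_simples) => i.
have X0 : \col_j (dimHom (X j) F)%:R = 0 :> 'cV[R]_m.
  by apply/matrixP => k l; rewrite !mxE ((dimHom_eq0 _ _).2 (hom_zero_retract (rX k) hMF)).
have Y0 : \col_j (dimHom (Y j) F)%:R = 0 :> 'cV[R]_p.
  by apply/matrixP => k l; rewrite !mxE ((dimHom_eq0 _ _).2 (hom_zero_retract (rY k) hPF)).
have : dv F = 0.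
  by apply: (row_full_kernel freeG le); rewrite mul_col_mx XdvE // YdvE X0 Y0 col_mx0.
by move=> /matrixP/(_ i 0); rewrite !mxE => /eqP; rewrite pnatr_eq0 => /eqP.
Qed.


(** The functional is the g-vector of the pair. On [Fac M] it is [dimHom M]. If Hom(M, F) = 0 it is
    at most zero, and a nonnegative value makes [f] ext-free on [F] and Hom(P, F) zero, so that
    [tau_tilting_sincere] applies. *)
Lemma tau_tilting_semistable M P : tau_tilting_pair M P ->
  exists delta : 'rV[R]_n, forall X, Fac M X <-> semistable_torsion S delta X.
Proof.
move=> [[pP /tau_rigidP rM hPM] count]; have [P1 [P0 [f [g [pres _ eM]]]]] := rM.
have [[pP1 pP0] _ _] := pres.
exists (hom_vec P0 - hom_vec P1 - hom_vec P) => X; rewrite Fac_gen.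
apply: gen_semistable => {X} [|X gX|F h0]; rewrite ?pairingB ?pairing_hom_vec //.
- exact: ext_rigid_torsion.
- rewrite ((presentation_eq X pres).2 (extfree_gen pP1 eM gX)).
  by rewrite ((dimHom_eq0 P X).2 (projective_hom_zero_gen pP hPM gX)) natrD addrK subr0.
have le := presentation_le F pres; rewrite ((dimHom_eq0 M F).2 h0) add0n in le.
rewrite -addrA -opprD subr_ge0 -natrD ler_nat => ge.
have P0F : dimHom P F = 0%N.
  by apply/eqP; rewrite -leqn0 -(leq_add2l (dimHom P1 F)) addn0 (leq_trans ge).
apply: (tau_tilting_sincere pres eM pP hPM count h0); last exact/dimHom_eq0.
apply/(presentation_eq F pres); rewrite ((dimHom_eq0 M F).2 h0) add0n.
by apply/eqP; rewrite eqn_leq le /= -[X in (X <= _)%N]addn0 -P0F.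
Qed.

Lemma left_finite_semistable U : left_finite U ->
  exists delta : 'rV[R]_n, forall X, tors U X <-> semistable_torsion S delta X.
Proof.
move=> /left_finite_gen[M tM E]; have [delta D] := torsion_gen_semistable tM.
by exists delta => X; rewrite E.
Qed.

(** As a semistable class containing [U], [tors U] also contains [V]. *)
Lemma tors_sub_newton U V : left_finite U ->
  (newton_polytope S R V `<=` newton_polytope S R U)%classic ->
  forall X, tors V X -> tors U X.
Proof.
move=> /left_finite_semistable[delta D] sub X tVX; apply: tVX; first exact: tors_torsion.
by apply/D; apply: semistable_newton sub _; apply/D; apply: tors_refl.
Qed.

End Semistable.

End Modules.

(** * Deduction of the five statements *)

Theorem theorem3p2 (R : realType) (K : fieldType) (A : falgType K)
    (A_basic : basic_algebra A)
    (n : nat) (S : 'I_n -> rmod A) (S_simples : simple_reps S)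
    (U V : rmod A)
    (eqN : newton_polytope S R U = newton_polytope S R V) :
  [/\ (forall delta : 'rV[R]_n,
         semistable_torsion S delta U <-> semistable_torsion S delta V) /\
      (forall M P : rmod A, tau_tilting_pair M P -> (Fac M U <-> Fac M V)),
      left_finite U -> left_finite V -> same_class (tors U) (tors V),
      left_finite U -> brick U -> left_finite V -> brick V -> iso_mod U V,
      indecomposable U -> tau_rigid U ->
        indecomposable V -> tau_rigid V -> iso_mod U V &
      tau_rigid U -> tau_rigid V -> tau_rigid (dsum U V)].
Proof.
have UV : (newton_polytope S R U `<=` newton_polytope S R V)%classic by rewrite eqN.
have VU : (newton_polytope S R V `<=` newton_polytope S R U)%classic by rewrite eqN.
have semi (delta : 'rV[R]_n) : semistable_torsion S delta U <-> semistable_torsion S delta V.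
  by split; [apply: semistable_newton VU|apply: semistable_newton UV].
have ii : left_finite U -> left_finite V -> same_class (tors U) (tors V).
  move=> lU lV X; split.
    exact: (tors_sub_newton S_simples lV UV).
  exact: (tors_sub_newton S_simples lU VU).
(* Rigid modules are left finite and [tors] agrees with [gen] for them, so the last two statements
   also rest on the equality of torsion classes. *)
have gen_eq : ext_rigid U -> ext_rigid V -> forall X, gen U X <-> gen V X.
  move=> rU rV X; rewrite -!tors_gen; try exact: ext_rigid_torsion.
  by apply: ii; apply: ext_rigid_left_finite.
split=> //.
- split=> // M P /(tau_tilting_semistable R S_simples)[delta D].
  by rewrite !D.
- by move=> lU bU lV bV; apply: brick_iso => //; apply: ii.
- move=> iU /tau_rigidP rU iV /tau_rigidP rV.
  by apply: indecomposable_gen_iso => //; apply: gen_eq.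
- move=> /tau_rigidP rU /tau_rigidP rV; apply/tau_rigidP.
  by apply: ext_rigid_dsum => //; apply: gen_eq.
Qed.
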